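(* Let $D$ be a virtual link diagram, and let $(CKh(D),d)$ be the complex constructed from $D$ and a choice of auxiliary structures $(\lambda,o,\{\sigma_s\},\{\star_s\})$: a local source-sink structure $\lambda$, an oriented direction system $o$ on $\lambda$, orders $\sigma_s$ of the components of all Kauffman states, and star points $\star_s(\gamma)$ on all components of all Kauffman states. Then: 1. $(CKh(D),d)$ is a chain complex, i.e. $d^2=0$; 2. the homology of $(CKh(D),d)$ does not depend (up to isomorphism) on the choice of the auxiliary structures; 3. the homology of $(CKh(D),d)$ coincides with the Khovanov homology of virtual links defined by Manturov and by Dye, Kaestner and Kauffman.
   Context: Diagrams and states. A virtual link diagram $D$ is a generic immersion of finitely many circles into the oriented plane, each transversal double point being marked classical (with over/under information) or virtual. $\mathcal X(D)$ is the set of classical crossings. Long arcs are arcs between consecutive classical crossings (they may contain virtual crossings). A state is a map $s\colon\mathcal X(D)\to\{0,1\}$; $S(D)$ is the set of states. $D_s$ is obtained by smoothing each classical crossing $c$ according to $s(c)$: the $0$-smoothing (A-smoothing) joins the two regions swept by the over-strand when it is rotated counterclockwise to the under-strand, and the $1$-smoothing joins the other two regions. $\Gamma(s)$ is the set of closed curves (components) of $D_s$; virtual crossings are ignored. Put $|s|=\sum_c s(c)$. Auxiliary structures. A local source-sink structure (LSSS) $\lambda$ is a choice, at each classical crossing, of one of the two source-sink orientations of its four half-edges: the two half-edges of one strand are directed into the crossing, and the two half-edges of the other strand are directed out of it. Place one cut locus on every long arc for which the directions given by $\lambda$ at its two ends do not agree to a common direction along the arc. Each component of each $D_s$ contains an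 even number of cut loci. An oriented direction system $o=\{o_c\}$ on $\lambda$ is a choice at each classical crossing $c$ of one of the two half-edges directed into $c$. Each smoothing at $c$ consists of two local arcs, exactly one of which contains the chosen half-edge; let $o^s_c(1)\in\Gamma(s)$ be the component containing this local arc and $o^s_c(2)\in\Gamma(s)$ the component containing the other local arc (they may coincide). For each $s$ choose a bijection $\sigma_s\colon\{1,\dots,|\Gamma(s)|\}\to\Gamma(s)$, and for each $\gamma\in\Gamma(s)$ a point $\star_s(\gamma)\in\gamma$ which is not a cut locus. Chains. $V=\mathbb Z[X]/(X^2)$ with multiplication $m$, comultiplication $\Delta(1)=1\otimes X+X\otimes1$, $\Delta(X)=X\otimes X$, and involution $\tau(1)=1$, $\tau(X)=-X$. Put $CKh(D)=\bigoplus_{s}V(s)$, $V(s)=V^{\otimes|\Gamma(s)|}$, where the $i$-th factor is the label of the component $\sigma_s(i)$ read at its star point. The summand $V(s)$ has homological degree $|s|$. For two points $p,q$ on one component, $l_\lambda(p,q)$ is the number mod 2 of cut loci on an arc of the component from $p$ to $q$. Differential. $d=\sum_{s\to s'}\partial_{s\to s'}$ over all pairs with $s(c)=0$, $s'(c)=1$ for one crossing $c$ and $s=s'$ elsewhere, with $\partial_{s\to s'}=\operatorname{sign}(s,s')\,\partial^0_{s\to s'}$. Components not passing by $c$ are identified in $D_s$ and $D_{s'}$, and on the corresponding factor $\gamma$ the map $\partial^0_{s\to s'}$ acts by $\tau^{l_\lambda(\star_s(\gamma),\star_{s'}(\gamma))}$ (moving factors to their places in the order $\sigma_{s'}$). Below,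 $c$ in $l_\lambda(c,\cdot)$ denotes a point of the component next to $c$. If a component $\gamma$ splits into $\gamma_1',\gamma_2'$, the remaining part of $\partial^0$ is $(\tau^{l_\lambda(c,\star_{s'}(\gamma_1'))}\otimes\tau^{l_\lambda(c,\star_{s'}(\gamma_2'))})\circ\Delta\circ\tau^{l_\lambda(c,\star_s(\gamma))}$, mapping the factor of $\gamma$ to the factors of $\gamma_1',\gamma_2'$. If $\gamma_1,\gamma_2$ merge into $\gamma'$, it is $\tau^{l_\lambda(c,\star_{s'}(\gamma'))}\circ m\circ(\tau^{l_\lambda(c,\star_s(\gamma_1))}\otimes\tau^{l_\lambda(c,\star_s(\gamma_2))})$. If one component is transformed to one component, $\partial_{s\to s'}=0$. Signs. For a crossing $c$, let $\sigma_s\setminus c$ be the order induced by $\sigma_s$ on the set of components of $D_s$ not passing by $c$, and let $\sigma_s\triangleleft(o,c)$ be the order on $\Gamma(s)$ which starts with the components passing by $c$, in the order $o^s_c(1),o^s_c(2)$ (one entry if they coincide), followed by the remaining components in the order $\sigma_s\setminus c$. For two orders $\sigma_1,\sigma_2$ of one finite set, $\epsilon(\sigma_1,\sigma_2)$ is the sign of the permutation $\sigma_1^{-1}\circ\sigma_2$. Then $$\operatorname{sign}(s,s')=\epsilon(\sigma_s,\sigma_s\triangleleft(o,c))\cdot\epsilon(\sigma_s\setminus c,\sigma_{s'}\setminus c)\cdot\epsilon(\sigma_{s'},\sigma_{s'}\triangleleft(o,c)).$$ Khovanov homology of Manturov and Dye–Kaestner–Kauffman (for item 3; homological grading by $|s|$,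 without the usual shift). Orient $D$. To a state $s$ assign the group generated by expressions $x_1\wedge\dots\wedge x_k$, one factor per component of $D_s$ listed in some order, where $x_i$ is $1$ or $X_{\omega}$ with $\omega$ an orientation of the corresponding component, multilinear, with $X_{-\omega}=-X_{\omega}$, and with a permutation of the factors multiplying the expression by the sign of the permutation. At a classical crossing $c$ drawn with both strands going up, the local orientation of the smoothing arcs is induced by the source-sink orientation obtained from the link orientation by reversing the two left half-edges. For the edge $s\to s'$ of the cube at $c$, write the components passing by $c$ first, oriented by this local orientation at $c$ and, if there are two of them, with the left one (if the two local arcs are side by side) or the upper one (if they lie one above the other) first; then apply $m$ or $\Delta$ to these factors (with $X=X_\omega$) and keep the remaining factors. The edge map is zero when one component turns into one component. The Khovanov homology is the homology of the resulting complex. *)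

(* Defs.v *)
From HB Require Import structures.
From mathcomp Require Import boolp reals topology normedtype derive.
From mathcomp Require Import all_boot all_order fingroup perm all_algebra.
From mathcomp Require Import lra.

Set Implicit Arguments.
Unset Strict Implicit.
Unset Printing Implicit Defensive.

Import Order.TTheory GRing.Theory Num.Theory.
Import numFieldNormedType.Exports.

Local Open Scope ring_scope.

Definition C1 (R : realType) (f : R -> R) : Prop :=
  (forall t, derivable f t 1) /\ continuous (derive1 f).

(* A circle is R/Z: the curves are 1-periodic, and a point of the i-th circle
   is a pair (i, t) with 0 <= t < 1.  At a classical double point x,
   [branch x true] lies on the over-strand and [branch x false] on the
   under-strand; at a virtual one the boolean merely names the two branches.
   Injectivity of [branch] excludes triple points. *)
Record vlink (R : realType) := VLink {
  ncirc : nat;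
  cx : 'I_ncirc -> R -> R;
  cy : 'I_ncirc -> R -> R;
  cx_C1 : forall i, C1 (cx i);
  cy_C1 : forall i, C1 (cy i);
  cx_periodic : forall i t, cx i (t + 1) = cx i t;
  cy_periodic : forall i t, cy i (t + 1) = cy i t;
  immersive : forall i t, (derive1 (cx i) t, derive1 (cy i) t) <> (0, 0);
  dpoint : finType;
  classical : pred dpoint;
  branch : dpoint -> bool -> 'I_ncirc * R;
  branch_range : forall x b, 0 <= (branch x b).2 < 1;
  branch_inj : injective (fun xb : dpoint * bool => branch xb.1 xb.2);
  branch_meet : forall x,
    let p := branch x true in let q := branch x false in
    cx p.1 p.2 = cx q.1 q.2 /\ cy p.1 p.2 = cy q.1 q.2;
  branch_all : forall i j t u, 0 <= t < 1 -> 0 <= u < 1 -> (i, t) <> (j, u) ->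
    cx i t = cx j u -> cy i t = cy j u ->
    exists x b, branch x b = (i, t) /\ branch x (~~ b) = (j, u);
  transverse : forall x,
    let p := branch x true in let q := branch x false in
    derive1 (cx p.1) p.2 * derive1 (cy q.1) q.2
      - derive1 (cy p.1) p.2 * derive1 (cx q.1) q.2 != 0
}.

(* What is left of a diagram when the virtual crossings are forgotten.  The
   pair (x, true), resp. (x, false), is the passage through the classical
   crossing x along its over-strand, resp. under-strand; [gnext] sends a
   passage to the next one on the same circle, so that long arcs join a
   passage to its successor.  [gpos x] tells whether (over, under) is a
   positive frame of the plane, both strands being directed by the
   parametrization of their circles. *)
Record gauss := Gauss {
  gX : finType;
  gpos : gX -> bool;
  gcirc : finType;
  gon : gX * bool -> gcirc;
  gnext : {perm gX * bool}
}.

Section GaussOf.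
Variables (R : realType) (D : vlink R).

Definition xing : finType := {x : dpoint D | classical x}.

Definition pos (p : xing * bool) : 'I_(ncirc D) * R := branch (val p.1) p.2.

(* The length, in (0, 1], of the path from t to u in R/Z. *)
Definition gap (t u : R) : R := if t < u then u - t else u - t + 1.

Definition next (p : xing * bool) : xing * bool :=
  [arg min_(q < p | (pos q).1 == (pos p).1) gap (pos p).2 (pos q).2]%O.

Lemma pos_inj : injective pos.
Proof.
move=> [x b] [y c] /(@branch_inj _ D (val x, b) (val y, c)).
by case=> /val_inj -> ->.
Qed.

Lemma pos_range p : 0 <= (pos p).2 < 1.
Proof. exact: branch_range. Qed.

Lemma next_inj : injective next.
Proof.
move=> p p'; rewrite /next.
case: Order.TotalTheory.arg_minP => // q /eqP qp qmin.
case: Order.TotalTheory.arg_minP => // q' /eqP q'p' q'min qq'; subst q'.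
have pp' : (pos p').1 = (pos p).1 by rewrite -q'p'.
apply: pos_inj; apply/eqP; rewrite [pos p]surjective_pairing.
rewrite [pos p']surjective_pairing pp' xpair_eqE eqxx /=.
have := qmin p'; rewrite pp' eqxx => /(_ isT).
have := q'min p; rewrite pp' eqxx => /(_ isT).
have := pos_range p; have := pos_range p'; have := pos_range q.
rewrite /gap; move: (pos p).2 (pos p').2 (pos q).2 => t t' u.
move=> /andP[? ?] /andP[? ?] /andP[? ?].
case: (ltgtP t t') => [||->]; rewrite ?ltxx ?eqxx //;
  case: (ltP t u) => ?; case: (ltP t' u) => ? ?; lra.
Qed.

Definition gauss_of : gauss := {|
  gX := xing;
  gpos := fun x =>
    let p := pos (x, true) in let q := pos (x, false) in
    0 < derive1 (cx p.1) p.2 * derive1 (cy q.1) q.2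
          - derive1 (cy p.1) p.2 * derive1 (cx q.1) q.2;
  gcirc := 'I_(ncirc D);
  gon := fun p => (pos p).1;
  gnext := perm next_inj
|}.

End GaussOf.

Section States.
Variable G : gauss.

(* (x, b, e) is the half-edge at x on the over-strand (b = true) or the
   under-strand (b = false) that leaves x in the direction of the
   parametrization (e = true) or against it (e = false). *)
Definition half : finType := (gX G * bool * bool)%type.

Definition hx (h : half) : gX G := h.1.1.
Definition over (h : half) : bool := h.1.2.
Definition onext (h : half) : bool := h.2.

Definition far (h : half) : half :=
  if onext h then (gnext G h.1, false) else ((gnext G)^-1%g h.1, true).

Definition opp (h : half) : half := (h.1, ~~ onext h).

Definition ccw (h : half) : half :=
  (hx h, ~~ over h, onext h (+) over h (+) gpos (hx h)).
Definition cw (h : half) : half := opp (ccw h).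

Definition state : finType := {ffun gX G -> bool}.

Definition weight (s : state) : nat := (\sum_x s x)%N.

(* The over-strand rotated counterclockwise sweeps the regions between an over
   half-edge h and [ccw h]; joining these two regions leaves one arc in each of
   the other two, so the 0-smoothing joins h to [cw h]. *)
Definition join (s : state) (h : half) : half :=
  if over h == s (hx h) then ccw h else cw h.

(* Circles without classical crossing; they are components of every state. *)
Definition free : finType := {k : gcirc G | [forall p, gon p != k]}.

(* Points of the states up to sliding: a point of a long arc is recorded by the
   end of the arc (that is, by the half-edge) lying on the same side of the
   cut locus; there is one point on each free circle. *)
Definition pt : finType := (half + free)%type.

Definition adj (s : state) : rel pt := fun p q =>
  match p, q with
  | inl h, inl k => (k == far h) || (k == join s h)
  | _, _ => false
  end.

Definition comp (s : state) (p : pt) : {set pt} := [set q | connect (adj s) p q].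

Definition Gamma (s : state) : {set {set pt}} := [set comp s p | p : pt].

Definition passes (x : gX G) (g : {set pt}) : bool :=
  [exists h, (hx h == x) && (inl h \in g)].

Definition edge (x : gX G) (s s' : state) : bool :=
  ~~ s x && (s' == [ffun y => (y == x) || s y]).

(* A local source-sink structure: [lam x] tells whether the half-edges directed
   into x are those of the over-strand or those of the under-strand. *)
Definition lsss := gX G -> bool.

Definition into (lam : lsss) (h : half) : bool := over h == lam (hx h).

Definition cut (lam : lsss) (h : half) : bool := into lam h == into lam (far h).

(* One step along a component, the boolean counting cut loci modulo 2. *)
Definition lstep (lam : lsss) (s : state) : rel (pt * bool) := fun u v =>
  match u.1, v.1 with
  | inl h, inl k => (k == far h) && (v.2 == u.2 (+) cut lam h)
                 || (k == join s h) && (v.2 == u.2)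
  | _, _ => false
  end.

(* Some path from p to q in D_s meets an odd number of cut loci. *)
Definition lpar (lam : lsss) (s : state) (p q : pt) : bool :=
  connect (lstep lam s) (p, false) (q, true).

(* The same with p any point of g next to x; when g splits at x, or results from
   a merge at x, all of them give the same parity. *)
Definition lnear (lam : lsss) (s : state) (x : gX G) (g : {set pt}) (q : pt) :=
  [exists h, [&& hx h == x, inl h \in g & lpar lam s (inl h) q]].

(* The order sigma_s is the list sigma_s(1), sigma_s(2), ... *)
Record aux := Aux {
  lam : lsss;
  odir : gX G -> half;
  odirP : forall x, hx (odir x) = x /\ into lam (odir x);
  ord : state -> seq {set pt};
  ordP : forall s, uniq (ord s) /\ ord s =i Gamma s;
  star : state -> {set pt} -> pt;
  starP : forall s g, g \in Gamma s -> star s g \in g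
}.

End States.

(* The permutation s1^-1 \o s2 of the positions and its sign, for
   duplicate-free lists s1, s2 of the same elements. *)
Definition ord_perm (T : eqType) (x0 : T) (s1 s2 : seq T) : 'S_(size s1) :=
  insubd (1%g : 'S_(size s1))
    [ffun i : 'I_(size s1) => insubd i (index (nth x0 s2 i) s1)].

Definition eps (T : finType) (s1 s2 : seq {set T}) : int :=
  (-1) ^+ odd_perm (ord_perm set0 s1 s2).

(* Structure constants in the basis 1 (false), X (true). *)
Definition mulV (a b c : bool) : int := (~~ (a && b) && (c == a || b))%:R.
Definition comulV (a b c : bool) : int :=
  (if a then b && c else b (+) c)%:R.
Definition tauV (l : bool) (a b : bool) : int :=
  if a == b then (-1) ^+ (l && a) else 0.

(* The local map from the components [g1, g2] (one component if they are equal)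
   to [h1, h2]: comultiplication, multiplication, or zero. *)
Definition localV (T : eqType) (g1 g2 h1 h2 : T) (a b : T -> bool) : int :=
  if (g1 == g2) && (h1 != h2) then comulV (a g1) (b h1) (b h2)
  else if (g1 != g2) && (h1 == h2) then mulV (a g1) (a g2) (b h1)
  else 0.

(* A graded group with differential, given by generators, relators, and the
   matrix of the differential on generators ([dif x y] is the coefficient of y
   in d x). *)
Record presentation := Presentation {
  gen : finType;
  deg : gen -> nat;
  relator : {ffun gen -> int} -> Prop;
  dif : gen -> gen -> int
}.

Section Homology.
Variable C : presentation.

Definition chain : zmodType := {ffun gen C -> int}.

Definition diff (v : chain) : chain := [ffun y => \sum_x v x * dif x y].

(* The subgroup generated by the relators. *)
Inductive null : chain -> Prop :=
| null_relator v : relator v -> null v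
| null0 : null 0
| nullB v w : null v -> null w -> null (v - w).

(* The support of v lies in degrees satisfying P. *)
Definition homog (P : pred nat) (v : chain) : Prop :=
  forall x, ~~ P (deg x) -> v x = 0.

Lemma homogB P v w : homog P v -> homog P w -> homog P (v - w).
Proof. by move=> hv hw x xi; rewrite !ffunE hv // hw // subrr. Qed.

Lemma homog0 P : homog P 0.
Proof. by move=> x _; rewrite ffunE. Qed.

Lemma diffB v w : diff (v - w) = diff v - diff w.
Proof.
apply/ffunP => y; rewrite !ffunE -sumrB; apply: eq_bigr => x _.
by rewrite !ffunE mulrBl.
Qed.

Lemma diff0 : diff 0 = 0.
Proof. by rewrite -[in LHS](subrr 0) diffB subrr. Qed.

(* Cocycles and coboundaries of degree i of the quotient complex [chain] / [null],
   as preimages in [chain]; with no relator, [null] is the zero subgroup. *)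
Definition cocycles (i : nat) : {pred chain} :=
  fun v => `[< homog (fun j => j == i) v /\ null (diff v) >].

Lemma cocycles_zmod_closed i : zmod_closed (cocycles i).
Proof.
split=> [|v w /asboolP[hv zv] /asboolP[hw zw]]; apply/asboolP.
  by rewrite diff0; split; [exact: homog0 | exact: null0].
by rewrite diffB; split; [exact: homogB | exact: nullB].
Qed.

HB.instance Definition _ i :=
  GRing.isZmodClosed.Build chain (cocycles i) (cocycles_zmod_closed i).

Record cocycle (i : nat) := Cocycle {
  cocycle_val :> chain;
  _ : cocycle_val \in cocycles i
}.

HB.instance Definition _ i := [isSub for @cocycle_val i].
HB.instance Definition _ i := [Choice of cocycle i by <:].
HB.instance Definition _ i := [SubChoice_isSubZmodule of cocycle i by <:].

Definition coboundaries (i : nat) : {pred cocycle i} := fun z =>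
  `[< exists2 w, homog (fun j => j.+1 == i) w & null (val z - diff w) >].

Lemma coboundaries_zmod_closed i : zmod_closed (@coboundaries i).
Proof.
split=> [|y z /asboolP[v hv nv] /asboolP[w hw nw]]; apply/asboolP.
  exists 0; first exact: homog0.
  by rewrite raddf0 diff0 subrr; exact: null0.
exists (v - w); first exact: homogB.
by rewrite raddfB diffB opprD addrACA -opprD; exact: nullB.
Qed.

HB.instance Definition _ i :=
  GRing.isZmodClosed.Build (cocycle i) (@coboundaries i)
    (coboundaries_zmod_closed i).

Definition homology (i : nat) : zmodType := {ideal_quot (@coboundaries i)}.

End Homology.

Definition isog (U V : zmodType) : Prop :=
  exists f : {additive U -> V}, bijective f.

Section CKh.
Variables (G : gauss) (A : aux G).

Definition away (x : gX G) (l : seq {set pt G}) : seq {set pt G} :=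
  [seq g <- l | ~~ passes x g].

(* o^s_x(1) and o^s_x(2): opposite half-edges never lie on the same local arc. *)
Definition o1 (s : state G) (x : gX G) : {set pt G} := comp s (inl (odir A x)).
Definition o2 (s : state G) (x : gX G) : {set pt G} :=
  comp s (inl (opp (odir A x))).

Definition passing (s : state G) (x : gX G) : seq {set pt G} :=
  undup [:: o1 s x; o2 s x].

Definition ord_at (s : state G) (x : gX G) : seq {set pt G} :=
  passing s x ++ away x (ord A s).

Definition edge_sign (s s' : state G) (x : gX G) : int :=
  eps (ord A s) (ord_at s x)
  * eps (away x (ord A s)) (away x (ord A s'))
  * eps (ord A s') (ord_at s' x).

(* The coefficient of the labelling b of Gamma s' in the image under
   partial^0 of the labelling a of Gamma s.  All powers of tau are diagonal. *)
Definition edge_coef (s s' : state G) (x : gX G) (a b : {set pt G} -> bool) : int :=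
  localV (o1 s x) (o2 s x) (o1 s' x) (o2 s' x) a b
  * (\prod_(g <- passing s x)
       tauV (lnear (lam A) s x g (star A s g)) (a g) (a g))
  * (\prod_(g <- passing s' x)
       tauV (lnear (lam A) s' x g (star A s' g)) (b g) (b g))
  * \prod_(g in Gamma s | ~~ passes x g)
       tauV (lpar (lam A) s (star A s g) (star A s' g)) (a g) (b g).

(* The basis of the sum of the V(s): a state s and a tensor of 1 (false) and
   X (true), whose i-th factor is the label of the i-th component of ord s. *)
Definition ckh_gen : finType :=
  {s : state G & (size (ord A s)).-tuple bool}.

Definition label (u : ckh_gen) (g : {set pt G}) : bool :=
  nth false (tagged u) (index g (ord A (tag u))).

Definition CKh : presentation := {|
  gen := ckh_gen;
  deg := fun u => weight (tag u);
  relator := fun _ => False;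
  dif := fun u v =>
    \sum_(x | edge x (tag u) (tag v))
      edge_sign (tag u) (tag v) x
      * edge_coef (tag u) (tag v) x (label u) (label v)
|}.

End CKh.

Section Khovanov.
Variables (G : gauss) (r : gcirc G -> bool).

(* The link is oriented: the circle k is directed by its parametrization if
   [r k] is true, against it otherwise. *)
Definition outward (h : half G) : bool := onext h == r (gon h.1).

(* With both strands drawn upwards, the half-edges are, counterclockwise, top
   right, top left, bottom left, bottom right, the top ones being outward. *)
Definition left (h : half G) : bool := outward (cw h).

(* The half-edges directed into the crossing, after reversal of the left ones. *)
Definition ss_into (h : half G) : bool := ~~ outward h (+) left h.

Definition topleft (x : gX G) : half G :=
  let h := (x, true, r (gon (x, true))) in
  if left h then h else (x, false, r (gon (x, false))).

(* The top left half-edge belongs to the left one of two local arcs placed side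
   by side, and to the upper one of two local arcs placed one above the other. *)
Definition c1 (s : state G) (x : gX G) : {set pt G} := comp s (inl (topleft x)).
Definition c2 (s : state G) (x : gX G) : {set pt G} :=
  comp s (inl (opp (topleft x))).

Definition strands (s : state G) (x : gX G) : seq {set pt G} :=
  undup [:: c1 s x; c2 s x].

(* An orientation of the component g is recorded by the set w of the half-edges
   of g which it directs into their crossing; the reverse orientation is then
   g :\: w.  The two orientations of a free circle are its singleton and the
   empty set. *)
Definition orientation (s : state G) (g w : {set pt G}) : bool :=
  (w \subset g) &&
  [forall h : half G, (inl h \in g) ==>
     ((inl (far h) \in w) == (inl h \notin w))
     && ((inl (join s h) \in w) == (inl h \notin w))].

Definition local_orientation (x : gX G) (g w : {set pt G}) : bool :=
  [forall h : half G, (hx h == x) && (inl h \in g) ==>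
     ((inl h \in w) == ss_into h)].

(* A factor of an expression: a component, with None for the factor 1 and Some w
   for the factor X_w. *)
Definition factor : finType := ({set pt G} * option {set pt G})%type.

Definition wf_factor (s : state G) (f : factor) : bool :=
  if f.2 is Some w then orientation s f.1 w else true.

Definition components (l : seq factor) : seq {set pt G} := [seq f.1 | f <- l].

Definition wf (u : {s : state G & #|Gamma s|.-tuple factor}) : bool :=
  perm_eq (components (tagged u)) (enum (Gamma (tag u)))
  && all (wf_factor (tag u)) (tagged u).

(* The expressions x_1 /\ ... /\ x_k. *)
Definition wedge : finType := {u : {s : state G & #|Gamma s|.-tuple factor} | wf u}.

Definition wstate (u : wedge) : state G := tag (val u).
Definition factors (u : wedge) : seq factor := tagged (val u).

Definition delta (u : wedge) : {ffun wedge -> int} := [ffun v => (u == v)%:R].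

Inductive wedge_relator : {ffun wedge -> int} -> Prop :=
| wedge_perm u v :
    wstate u = wstate v -> perm_eq (factors u) (factors v) ->
    wedge_relator
      (delta v - delta u *~ eps (components (factors u)) (components (factors v)))
| wedge_reverse u v l1 l2 g w :
    wstate u = wstate v ->
    factors u = l1 ++ (g, Some w) :: l2 ->
    factors v = l1 ++ (g, Some (g :\: w)) :: l2 ->
    wedge_relator (delta u + delta v).

Definition xlabel (l : seq factor) (g : {set pt G}) : bool :=
  has (fun f => (f.1 == g) && (f.2 != None)) l.

(* The sign of the rewriting of the factors passing by x in terms of the local
   orientation. *)
Definition local_sign (x : gX G) (l : seq factor) : int :=
  \prod_(f <- l | passes x f.1)
    (if f.2 is Some w then (if local_orientation x f.1 w then 1 else -1) else 1).

(* The coefficient of the expression l' of the state s' in the image of the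
   expression l of the state s under the edge map at x: after the factors
   passing by x have been moved to the front of l and oriented locally, l' must
   consist of locally oriented factors on the components of s' passing by x,
   followed by the other factors of l. *)
Definition wedge_coef (s s' : state G) (x : gX G) (l l' : seq factor) : int :=
  let rest := [seq f <- l | ~~ passes x f.1] in
  let k := size (strands s' x) in
  let front := take k l' in
  if [&& components front == strands s' x, drop k l' == rest &
         all (fun f => if f.2 is Some w then local_orientation x f.1 w else true)
             front]
  then eps (components l) (strands s x ++ components rest)
       * local_sign x l
       * localV (c1 s x) (c2 s x) (c1 s' x) (c2 s' x) (xlabel l) (xlabel l')
  else 0.

Definition Kh : presentation := {|
  gen := wedge;
  deg := fun u => weight (wstate u);
  relator := wedge_relator;
  dif := fun u v =>
    \sum_(x | edge x (wstate u) (wstate v))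
      wedge_coef (wstate u) (wstate v) x (factors u) (factors v)
|}.

End Khovanov.

(* Main.v *)
From HB Require Import structures.
From mathcomp Require Import boolp reals.
From mathcomp Require Import all_boot fingroup perm all_algebra.
From mathcomp Require Import ring.
Require Import Defs.

Set Implicit Arguments.
Unset Strict Implicit.
Unset Printing Implicit Defensive.

Import GRing.Theory.

Local Open Scope ring_scope.

(** Why the theorem holds.

    In a state, a component alternates between crossing a long arc ([far]) and
    turning at a crossing ([join s]).  Both are involutions without fixed point,
    so the half-edges of a component fall into two sides, and two half-edges are
    on the same side when [along s] holds; the two sides are the two orientations
    of the component.  A source-sink structure distinguishes half-edges directed
    in from those directed out.  Turning always passes from one kind to the other,
    crossing a long arc does so unless there is a cut locus on it.  The number of
    cut loci between two points of a component is therefore, modulo 2, a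
    difference of the values of one function [theta] at the two points
    ([lparE]).  The sign comparing two orders is likewise a product of one factor
    for each order ([eps_rho]).  After a change of sign of the basis vectors
    ([gauge]), the coefficient of an edge of the cube becomes [core], in which
    the orders, the star points and the source-sink structure do not occur any
    more ([edge_coefE]); what is left is the half-edge chosen at the crossing, and
    another choice multiplies all edges at this crossing by one sign ([core_opp],
    [core_join]).

    d^2 = 0 means that the two paths around each face of the cube cancel.  The
    states of a face agree outside of two crossings, so the diagram enters
    only through the way in which the outside connects the eight half-edges at
    these crossings in pairs ([first_return]).  There are 105 matchings of eight
    points, and in each of them the cancellation is a finite computation
    ([all_faces_ok]); [core_table] identifies the coefficients of the diagram with
    the computed ones.

    In the complex of Manturov and of Dye, Kaestner and Kauffman, the local
    orientation at a crossing is a source-sink orientation, and the top left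
    half-edge is one directed into the crossing.  The relators make
    each expression a sign times the basis vector with the same labels.  Sending
    an expression to this multiple ([forget]) is onto, its kernel is the subgroup
    generated by the relators ([forgetK]), and it takes the edge maps of one
    complex to those of the other ([wedge_entry]).  This gives the third
    statement, and the second one follows by comparing two choices of
    auxiliary structures with the same complex of expressions. *)

(** * Signs of orders *)

(** The sign of the permutation that sorts a list of distinct numbers. *)
Fixpoint rho (l : seq nat) : int :=
  if l is x :: l' then (-1) ^+ count (fun y => y < x)%N l' * rho l' else 1.

Lemma rho_sq l : rho l * rho l = 1.
Proof.
elim: l => //= x l IHl.
by rewrite mulrACA IHl -expr2 sqrr_sign mulr1.
Qed.

Lemma rho_cat l1 l2 :
  rho (l1 ++ l2) = rho l1 * rho l2
    * \prod_(x <- l1) (-1) ^+ count (fun y => y < x)%N l2.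
Proof.
elim: l1 => [|x l1 IHl] /=; first by rewrite big_nil mulr1 mul1r.
rewrite big_cons IHl count_cat exprD !mulrA; congr (_ * _).
by rewrite [RHS]mulrAC -!mulrA; congr (_ * _); rewrite mulrCA.
Qed.

Lemma rho_swap x y l : x != y -> rho [:: x, y & l] = - rho [:: y, x & l].
Proof.
rewrite /= !exprD => nxy.
case: ltngtP nxy => //= _ _; rewrite ?expr0 ?expr1 ?mul1r ?mulN1r ?mulNr ?opprK;
  by rewrite mulrCA.
Qed.

Lemma rho_move x u v :
  x \notin u -> rho (u ++ x :: v) = (-1) ^+ size u * rho (x :: u ++ v).
Proof.
elim: u => [|y u IHu]; first by rewrite mul1r.
rewrite inE negb_or => /andP[nxy xu].
transitivity ((-1) ^+ size u * rho [:: y, x & u ++ v]).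
  rewrite cat_cons [LHS]/= IHu // [rho [:: y, _ & _]]/= count_cat /=.
  rewrite mulrCA; congr (_ * (_ ^+ _ * _)).
  by rewrite count_cat addnCA.
by rewrite rho_swap 1?eq_sym // mulrN exprS mulN1r mulNr.
Qed.

Section OrdPerm.
Variables (T : eqType) (x0 : T).

Lemma ord_permE (s1 s2 : seq T) (i : 'I_(size s1)) :
  uniq s1 -> perm_eq s1 s2 ->
  val (ord_perm x0 s1 s2 i) = index (nth x0 s2 i) s1.
Proof.
move=> u1 e12; have u2 : uniq s2 by rewrite -(perm_uniq e12).
have sz := perm_size e12.
have lt_idx (j : 'I_(size s1)) : (index (nth x0 s2 j) s1 < size s1)%N.
  by rewrite index_mem (perm_mem e12) mem_nth // -sz.
rewrite /ord_perm -pvalE val_insubd ifT ?ffunE; last first.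
  apply/injectiveP => j k; rewrite !ffunE => /(congr1 val).
  rewrite !val_insubd !lt_idx => e; apply/val_inj/eqP.
  rewrite -(nth_uniq x0 _ _ u2) -?sz ?ltn_ord //; apply/eqP.
  have mem_s1 (l : 'I_(size s1)) : nth x0 s2 l \in s1.
    by rewrite (perm_mem e12) mem_nth // -sz.
  by rewrite -[LHS](nth_index x0 (mem_s1 j)) e nth_index.
by rewrite val_insubd lt_idx.
Qed.

(** Deleting one element from both lists deletes one row and one column of the
    permutation matrix, as in the expansion of a determinant. *)
Lemma ord_perm_cons x (a u v : seq T) (i : 'I_(size a).+1) :
  val i = size u -> uniq (x :: a) -> perm_eq (x :: a) (u ++ x :: v) ->
  ord_perm x0 (x :: a) (u ++ x :: v) =
    lift_perm i ord0 (ord_perm x0 a (u ++ v)).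
Proof.
move=> iu ua pe.
have pe' : perm_eq a (u ++ v).
  by rewrite -(perm_cons x) (perm_trans pe) // -(cat1s x v) perm_catCA.
apply/permP => j; apply: val_inj; rewrite ord_permE //.
case: (unliftP i j) => [k|] ->; last first.
  by rewrite lift_perm_id iu nth_cat ltnn subnn /= eqxx.
rewrite lift_perm_lift [RHS]/= /bump leq0n add1n ord_permE //; last first.
  by case/andP: ua.
have -> : nth x0 (u ++ x :: v) (lift i k) = nth x0 (u ++ v) k.
  rewrite !nth_cat /= /bump iu; case: (leqP (size u) k) => /= uk.
    by rewrite add1n [(k.+1 < _)%N]ltnNge leqW //= subSn //= ltnNge uk.
  by rewrite add0n uk.
rewrite /= ifN //; case/andP: ua => xa _; apply: contraNneq xa => ->.
by rewrite (perm_mem pe') mem_nth // -(perm_size pe').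
Qed.

End OrdPerm.

(** Both orders are compared with the increasing order of the ranks, whence the
    product form; it makes every product of signs around a cycle of orders trivial. *)
Lemma eps_rho (T : finType) (rank : {set T} -> nat) (s1 s2 : seq {set T}) :
  uniq (map rank s1) -> perm_eq s1 s2 ->
  eps s1 s2 = rho (map rank s1) * rho (map rank s2).
Proof.
elim: s1 s2 => [|x a IHa] s2 ur pe.
  move: pe; rewrite perm_sym => /perm_nilP ->; rewrite /eps mul1r.
  suff -> : ord_perm (set0 : {set T}) [::] [::] = 1%g by rewrite odd_perm1.
  by apply/permP => -[].
have [u [v def_s2]] : exists u v, s2 = u ++ x :: v.
  have xs2 : x \in s2 by rewrite -(perm_mem pe) mem_head.
  by case/splitPr: xs2 => u v; exists u, v.
subst s2; have ua := map_uniq ur.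
have lt_u : (size u < (size a).+1)%N.
  by have := perm_size pe; rewrite size_cat /= addnS => ->; rewrite ltnS leq_addr.
have pe' : perm_eq a (u ++ v).
  by rewrite -(perm_cons x) (perm_trans pe) // -(cat1s x v) perm_catCA.
rewrite /eps (@ord_perm_cons _ _ _ _ _ _ (Ordinal lt_u)) // odd_lift_perm /=.
rewrite addbF signr_addb signr_odd -/(eps a (u ++ v)) IHa //; last first.
  by case/andP: ur.
rewrite !map_cat /= rho_move ?size_map; last first.
  have := ur; rewrite (perm_uniq (perm_map rank pe)) map_cat cat_uniq /=.
  by case/and3P=> _; rewrite negb_or => /andP[].
rewrite /= -map_cat.
have -> : count (fun y => y < rank x)%N (map rank (u ++ v)) =
          count (fun y => y < rank x)%N (map rank a).
  by apply/esym/seq.permP; rewrite perm_map.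
rewrite [RHS]mulrCA; congr (_ * _).
by rewrite mulrACA -expr2 sqrr_sign mul1r.
Qed.

(** * Components of a state and their two sides *)

Section HalfEdges.
Variable G : gauss.
Implicit Types (s t : state G) (h k : half G) (p q : pt G) (g : {set pt G}).

Lemma farK : involutive (@far G).
Proof. by case=> p [] ; rewrite /far /onext /= ?permK ?permKV. Qed.

Lemma far_neq h : far h != h.
Proof. by case: h => p []; rewrite /far /onext /= -pair_eqE /= andbF. Qed.

Lemma oppK : involutive (@opp G).
Proof. by case=> [[x b] e]; rewrite /opp /onext /= negbK. Qed.

Lemma hx_opp h : hx (opp h) = hx h. Proof. by []. Qed.

(** Turning exchanges the strands, and the state enters only through the last bit:
    the two smoothings at a crossing differ by [opp]. *)
Lemma joinE s h :
  join s h = (hx h, ~~ over h, onext h (+) gpos (hx h) (+) s (hx h)).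
Proof.
case: h => [[x b] e]; rewrite /join /cw /ccw /opp /hx /over /onext /=.
by case: b; case: (s x) => /=; case: e; case: (gpos x).
Qed.

Lemma hx_join s h : hx (join s h) = hx h. Proof. by rewrite joinE. Qed.

Lemma over_join s h : over (join s h) = ~~ over h. Proof. by rewrite joinE. Qed.

Lemma joinK s : involutive (join s).
Proof.
case=> [[x b] e]; rewrite !joinE /hx /over /onext /= negbK.
by rewrite -!addbA [s x (+) _]addbCA addbb addbF addbb addbF.
Qed.

Lemma join_neq s h : join s h != h.
Proof.
by apply/eqP => /(congr1 (@over G)); rewrite over_join; case: (over h).
Qed.

Lemma join_opp s h : join s (opp h) = opp (join s h).
Proof. by rewrite !joinE /opp /onext /= !addNb. Qed.

Lemma join_same s t h : s (hx h) = t (hx h) -> join s h = join t h.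
Proof. by rewrite !joinE => ->. Qed.

Lemma join_flip s t h : t (hx h) = ~~ s (hx h) -> join t h = opp (join s h).
Proof. by rewrite !joinE /opp /onext /= => ->; rewrite addbN. Qed.

Lemma hx_eq s h k :
  hx h = hx k -> [|| h == k, h == opp k, h == join s k | h == opp (join s k)].
Proof.
case: h k => [[x b] e] [[y c] f]; rewrite /hx /= => ->.
rewrite !joinE /opp /hx /over /onext /= !xpair_eqE !eqxx /=.
by case: b; case: c; case: e; case: f => //=;
  case: (gpos y); case: (s y).
Qed.

Arguments hx_eq s {h k}.

(** The orbits of this permutation are the components with an orientation. *)
Definition turn s h : half G := join s (far h).

Lemma turn_inj s : injective (turn s).
Proof. exact: inj_comp (can_inj (joinK s)) (can_inj farK). Qed.

Lemma turn_far s h : turn s (far h) = join s h.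
Proof. by rewrite /turn farK. Qed.

Lemma far_turn s h : turn s (far (turn s h)) = far h.
Proof. by rewrite /turn farK joinK. Qed.

Definition along s h k : bool := fconnect (turn s) h k.

Lemma along_refl s h : along s h h. Proof. exact: connect0. Qed.

Lemma along_sym s h k : along s h k = along s k h.
Proof. exact/fconnect_sym/turn_inj. Qed.

Lemma along_trans s : transitive (along s).
Proof. by move=> k h l; apply: connect_trans. Qed.

Lemma along_turn s h : along s h (turn s h). Proof. exact: fconnect1. Qed.

Lemma along_iter s n h : along s h (iter n (turn s) h).
Proof. exact: fconnect_iter. Qed.

Lemma alongP s h k : reflect (exists n, iter n (turn s) h = k) (along s h k).
Proof.
apply: (iffP idP) => [/iter_findex <- | [n <-]]; last exact: along_iter.
by exists (findex (turn s) h k).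
Qed.

(** Following the component backwards from the far end runs through the same long
    arcs, by [far_turn]. *)
Lemma along_far s h k : along s (far h) (far k) = along s h k.
Proof.
suff sub h' k' : along s h' k' -> along s (far h') (far k').
  by apply/idP/idP => [/sub|/sub //]; rewrite !farK.
case/alongP=> n <- /=; elim: n => [|n IHn]; first exact: along_refl.
apply: along_trans IHn _; rewrite along_sym.
by rewrite -(far_turn s (iter n _ h')); exact: along_turn.
Qed.

Lemma along_join s h : along s (far h) (join s h).
Proof. by rewrite -turn_far; exact: along_turn. Qed.

Lemma along_congl s h k l : along s h k -> along s h l = along s k l.
Proof.
move=> hk; apply/idP/idP; last exact: along_trans.
by apply: along_trans; rewrite along_sym.
Qed.

(** The step that makes components two-sided: were a half-edge and its far end
    on the same side, the middle of the path between them would be fixed by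
    [far] or by [join s]. *)
Lemma far_not_along s h : along s h (far h) = false.
Proof.
apply/negP=> /alongP[n]; elim/ltn_ind: n h => -[|[|n]] IHn h e.
- by have := far_neq h; rewrite -e eqxx.
- by case/eqP: (join_neq s (far h)).
(* the path from turn s h to its far end is shorter by one step at each end *)
apply: (IHn n _ (turn s h)) => //; apply: (@turn_inj s).
by rewrite far_turn -e -iterS -iterSr.
Qed.

Lemma along_or s h k :
  along s h k || along s (far h) k -> along s (far h) k = ~~ along s h k.
Proof.
case/orP=> hk; rewrite hk ?negbK.
  apply/negbTE/negP => fk; have := far_not_along s h.
  by rewrite (along_congl _ hk) along_sym fk.
apply/esym/negP => fk; have := far_not_along s h.
by rewrite (along_congl _ fk) along_sym hk.
Qed.

Lemma adj_sym s : symmetric (adj s).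
Proof.
case=> [h|k] [h'|k'] //=.
by rewrite eq_sym (can2_eq farK farK) (eq_sym h' (join _ _))
  (can2_eq (joinK s) (joinK s)) (eq_sym h).
Qed.

Lemma connect_adj_sym s : connect_sym (adj s).
Proof. exact/sym_connect_sym/adj_sym. Qed.

(** The form that equality of components takes for half-edges ([comp_half_eq]). *)
Definition linked s h k : bool := along s h k || along s (far h) k.

Lemma connect_half s h k : connect (adj s) (inl h) (inl k) = linked s h k.
Proof.
apply/idP/idP.
  pose A := [pred p : pt G | if p is inl l then linked s h l else false].
  suff clA : closed (adj s) A.
    move=> hk; have := closed_connect clA hk.
    by rewrite !inE /linked along_refl => <-.
  apply: (intro_closed (@connect_adj_sym s)) => -[l|?] [m|?] //=; rewrite !inE /linked.
  have sw n m' : along s (far l) m' -> along s n l || along s (far n) l ->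
                 along s n m' || along s (far n) m'.
    move=> lm /orP[] nl.
      by rewrite orbC (along_trans _ lm) // along_far.
    by rewrite (along_trans _ lm) // -along_far farK.
  case/orP=> /eqP->; apply: sw; [exact: along_refl|exact: along_join].
have along_connect l m : along s l m -> connect (adj s) (inl l) (inl m).
  case/alongP=> n <-; elim: n => //= n IHn; apply: connect_trans IHn _.
  apply: (connect_trans (y := inl (far (iter n (turn s) l)))); apply: connect1;
    by rewrite /= eqxx ?orbT.
case/orP=> /along_connect // fk; apply: connect_trans fk.
by apply: connect1; rewrite /= eqxx.
Qed.

Lemma connect_free s (f : free G) p : connect (adj s) (inr f) p = (p == inr f).
Proof.
apply/idP/eqP => [|->]; last exact: connect0.
by case/connectP=> -[|q l] //= /andP[].
Qed.

Lemma in_comp s p q : (q \in comp s p) = connect (adj s) p q.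
Proof. by rewrite inE. Qed.

Lemma comp_refl s p : p \in comp s p. Proof. by rewrite inE. Qed.

Lemma comp_eqP s p q : (comp s p == comp s q) = (q \in comp s p).
Proof.
apply/eqP/idP => [->|]; first exact: comp_refl.
rewrite inE => pq; apply/setP => r; rewrite !inE.
exact: (same_connect (@connect_adj_sym s) pq).
Qed.

Lemma comp_eq s p q : q \in comp s p -> comp s q = comp s p.
Proof. by rewrite -comp_eqP => /eqP. Qed.

Lemma comp_half_eq s h k : (comp s (inl h) == comp s (inl k)) = linked s h k.
Proof. by rewrite comp_eqP in_comp connect_half. Qed.

Lemma linked_sym s h k : linked s h k = linked s k h.
Proof. by rewrite -!comp_half_eq eq_sym. Qed.

Lemma in_comp_half s h k : (inl k \in comp s (inl h)) = linked s h k.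
Proof. by rewrite in_comp connect_half. Qed.

Lemma comp_free s (f : free G) : comp s (inr f) = [set inr f].
Proof. by apply/setP => p; rewrite !inE connect_free. Qed.

Lemma Gamma_comp s p : comp s p \in Gamma s. Proof. exact: imset_f. Qed.

Lemma GammaP s g p : g \in Gamma s -> p \in g -> g = comp s p.
Proof. by case/imsetP=> q _ -> pq; rewrite (comp_eq pq). Qed.

Lemma Gamma_neq0 s g : g \in Gamma s -> exists p, p \in g.
Proof. by case/imsetP=> p _ ->; exists p; apply: comp_refl. Qed.

Lemma comp_join s h : comp s (inl (join s h)) = comp s (inl h).
Proof. by apply: comp_eq; rewrite in_comp; apply: connect1; rewrite /= eqxx orbT. Qed.

Lemma comp_far s h : comp s (inl (far h)) = comp s (inl h).
Proof. by apply: comp_eq; rewrite in_comp; apply: connect1; rewrite /= eqxx. Qed.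

Lemma passesP x g : reflect (exists2 h, hx h = x & inl h \in g) (passes x g).
Proof.
apply: (iffP existsP) => [[h /andP[/eqP ? ?]]|[h <- hg]]; exists h => //.
by rewrite eqxx hg.
Qed.

Lemma passes_comp s h g :
  g \in Gamma s ->
  passes (hx h) g = (g \in [:: comp s (inl h); comp s (inl (opp h))]).
Proof.
move=> gG; rewrite !inE; apply/passesP/orP; last first.
  case=> /eqP->; [exists h | exists (opp h)] => //; exact: comp_refl.
case=> k kh kg; rewrite (GammaP gG kg).
case/or4P: (hx_eq s kh) => /eqP ->; rewrite -?join_opp ?comp_join eqxx; by [left|right].
Qed.

End HalfEdges.

(** * Changing the smoothing at some crossings *)

Section Resmoothing.
Variable G : gauss.
Implicit Types (s t : state G) (h k : half G) (p q : pt G) (g : {set pt G}).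

Section Agree.
Variables (s t : state G) (h : half G).
Hypothesis agree : forall k, linked s h k -> s (hx k) = t (hx k).

Lemma iter_turn_agree n : iter n (turn t) h = iter n (turn s) h.
Proof.
elim: n => //= n ->; apply/esym/join_same/agree.
by rewrite /linked along_far along_iter orbT.
Qed.

Lemma along_agree k : along t h k = along s h k.
Proof.
by apply/(alongP t h k)/(alongP s h k) => -[n <-]; exists n; rewrite iter_turn_agree.
Qed.

Lemma linked_agree k : linked t h k = linked s h k.
Proof. by rewrite /linked -{2 4}(farK k) !along_far !along_agree. Qed.

(** Following the component never leaves the crossings where the states agree. *)
Lemma comp_agree : comp t (inl h) = comp s (inl h).
Proof.
apply/setP=> -[k|f]; first by rewrite !in_comp_half linked_agree.
by rewrite !in_comp ![connect _ (inl h) _]connect_adj_sym !connect_free.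
Qed.

End Agree.

Lemma Gamma_agree s t g :
  g \in Gamma s -> (forall h, inl h \in g -> s (hx h) = t (hx h)) ->
  g \in Gamma t.
Proof.
case/imsetP=> -[h|f] _ -> agree; last by rewrite comp_free -(comp_free t) Gamma_comp.
rewrite -(comp_agree (t := t)) ?Gamma_comp // => k hk; apply: agree.
by rewrite in_comp_half.
Qed.

Section FirstReturn.
Variable K : pred (gX G).

(** The half-edge at which the path that leaves [h] along its long arc comes back
    to a crossing of [K] for the first time. *)
Definition first_return s h : half G :=
  let l := orbit (turn s) h in far (nth h l (find (fun k => K (hx (far k))) l)).

(** Following the component leads back to [h] in the end, and the last step of
    that walk turns at the crossing of [h], which is in [K]. *)
Lemma first_returnP s h : K (hx h) ->
  exists n, [/\ first_return s h = far (iter n (turn s) h), K (hx (first_return s h))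
    & forall i, (i < n)%N -> ~~ K (hx (far (iter i (turn s) h)))].
Proof.
move=> Kh; set a := fun k => K (hx (far k)).
have has_a : has a (orbit (turn s) h).
  apply/hasP; exists (iter (fingraph.order (turn s) h).-1 (turn s) h).
    by rewrite -fconnect_orbit fconnect_iter.
  rewrite /a -(hx_join s) -/(turn s _) -iterS prednK ?order_gt0 //.
  by rewrite iter_order //; apply: turn_inj.
have lt_f : (find a (orbit (turn s) h) < fingraph.order (turn s) h)%N.
  by rewrite -(size_orbit (turn s) h) -has_find.
exists (find a (orbit (turn s) h)).
have nthE i : (i < fingraph.order (turn s) h)%N ->
    nth h (orbit (turn s) h) i = iter i (turn s) h.
  by move=> lt_i; rewrite /orbit nth_traject.
split; first by rewrite /first_return nthE.
  exact: (nth_find h has_a).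
move=> i lt_i; have := before_find h lt_i.
by rewrite nthE ?(ltn_trans lt_i) // => /negbT.
Qed.

Lemma first_return_uniq s h n :
  K (hx h) -> K (hx (far (iter n (turn s) h))) ->
  (forall i, (i < n)%N -> ~~ K (hx (far (iter i (turn s) h)))) ->
  first_return s h = far (iter n (turn s) h).
Proof.
move=> Kh Kn minn; have [m [bE Kback minm]] := first_returnP s Kh; rewrite bE.
case: (ltngtP m n) => [lt|lt|-> //].
  by have := minn _ lt; rewrite -bE Kback.
by have := minm _ lt; rewrite Kn.
Qed.

Lemma first_return_in s h : K (hx h) -> K (hx (first_return s h)).
Proof. by move/(first_returnP s) => [n []]. Qed.

Lemma first_return_along s h : K (hx h) -> along s (far h) (first_return s h).
Proof. by move/(first_returnP s) => [n [-> _ _]]; rewrite along_far along_iter. Qed.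

(** The reverse path visits the same crossings. *)
Lemma first_returnK s h : K (hx h) -> first_return s (first_return s h) = h.
Proof.
move=> Kh; have [n [bE Kb minn]] := first_returnP s Kh.
have rev i : (i <= n)%N ->
    far (iter i (turn s) (first_return s h)) = iter (n - i) (turn s) h.
  elim: i => [|i IHi] lt_i; first by rewrite subn0 bE farK.
  by rewrite iterS {1}/turn IHi 1?ltnW // -(subnSK lt_i) iterS /turn joinK farK.
rewrite -[RHS](_ : far (iter n (turn s) (first_return s h)) = _); last first.
  by rewrite rev // subnn.
apply: first_return_uniq => // [|i lt_i]; first by rewrite rev // subnn.
by rewrite rev 1?ltnW // -(subnSK lt_i) iterS hx_join minn // subnSK // leq_subr.
Qed.

Section SameOff.
Variables s t : state G.
Hypothesis same : forall y, ~~ K y -> s y = t y.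

(** Before its return the path meets only crossings outside of [K]. *)
Lemma first_return_same h : K (hx h) -> first_return t h = first_return s h.
Proof.
move=> Kh; have [n [bE Kb minn]] := first_returnP s Kh.
have it i : (i <= n)%N -> iter i (turn t) h = iter i (turn s) h.
  elim: i => //= i IHi lt_i; rewrite IHi 1?ltnW //; apply/esym/join_same/same.
  exact: minn.
rewrite bE -it //; apply: first_return_uniq; rewrite ?it // -?bE // => i lt_i.
by rewrite it ?minn // ltnW.
Qed.

End SameOff.

(** The sides of the components that pass by [K] are thus determined by the first
    return map and by the smoothings at [K]. *)
Lemma along_returnP s h k : K (hx h) -> K (hx k) ->
  reflect (exists n, iter n (join s \o first_return s) h = k) (along s h k).
Proof.
move=> Kh Kk; apply: (iffP idP) => [/alongP[n]|[n <-]]; last first.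
  elim: n => [|n IHn] /=; first exact: along_refl.
  have Kn : K (hx (iter n (join s \o first_return s) h)).
    by case: n {IHn} => //= n; rewrite hx_join first_return_in //;
      elim: n => //= n IHn; rewrite hx_join first_return_in.
  apply: along_trans IHn _; rewrite -along_far.
  apply: along_trans (first_return_along _ Kn) _.
  by rewrite -along_far farK along_join.
elim/ltn_ind: n h Kh => -[|n] IHn h Kh nhk; first by exists 0%N.
have [m [bE Kb minm]] := first_returnP s Kh.
have le_mn : (m <= n)%N.
  rewrite leqNgt; apply/negP => /minm; rewrite -(hx_join s).
  by rewrite -[join _ _]/(iter n.+1 (turn s) h) nhk Kk.
have [|||j jk] := IHn (n - m)%N _ (join s (first_return s h)).
- by rewrite ltnS leq_subr.
- by rewrite hx_join first_return_in.
- by rewrite -nhk -{2}(subnK le_mn) -addnS iterD /= bE.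
by exists j.+1; rewrite iterSr.
Qed.

End FirstReturn.

(** If switching the crossing of [h] leaves the two strands of [t] there on
    distinct components, then before the switch they lie on one component
    and run along it in the same direction.  Of the three ways in which the four
    half-edges at the crossing can be joined from outside, only one is left. *)
Lemma along_opp s t h :
  (forall y, y != hx h -> s y = t y) -> t (hx h) = ~~ s (hx h) ->
  ~~ linked t h (opp h) -> along s h (opp h).
Proof.
move=> same flip nlk; pose K := pred1 (hx h).
have Kh : K (hx h) by exact: eqxx.
have as_ := first_return_along s Kh.
have at_ : along t (far h) (first_return K s h).
  by rewrite -(@first_return_same K s t) // first_return_along.
have /eqP/(hx_eq s) := first_return_in s Kh; case/or4P => /eqP e; rewrite e in as_ at_.
- by rewrite along_sym far_not_along in as_.
- by rewrite /linked at_ orbT in nlk.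
- have sw : join s h = join t (opp h).
    by rewrite join_opp; apply: join_flip; rewrite flip negbK.
  case/negP: nlk; rewrite -comp_half_eq -(comp_join t (opp h)) -sw.
  by rewrite comp_half_eq /linked at_ orbT.
- rewrite -along_far; apply: along_trans as_ _.
  by rewrite -join_opp along_sym along_join.
Qed.

End Resmoothing.

(** * Parity of cut loci *)

Section Parity.
Variable G : gauss.
Implicit Types (s t : state G) (h k : half G) (p q : pt G) (g : {set pt G}).

Variable rep : {set pt G} -> option (pt G).
Hypothesis repP : forall g p, p \in g -> exists2 q, rep g = Some q & q \in g.

(** Whether [p] lies on the side opposite to the point [rep] of its component.  The
    value of [rep] is an option since a diagram may have no point at all. *)
Definition side s p : bool :=
  if (rep (comp s p), p) is (Some (inl k), inl h) then ~~ along s k h else false.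

Lemma rep_half s h :
  exists2 r, rep (comp s (inl h)) = Some (inl r) & linked s r h.
Proof.
have [[r|f] -> ] := repP (comp_refl s (inl h)).
  by rewrite in_comp_half linked_sym; exists r.
by rewrite in_comp connect_adj_sym connect_free.
Qed.

Lemma side_along s h k : along s h k -> side s (inl k) = side s (inl h).
Proof.
move=> hk; have e : comp s (inl k) = comp s (inl h).
  by apply/eqP; rewrite comp_half_eq /linked along_sym hk.
rewrite /side e; have [r -> _] := rep_half s h; congr (~~ _).
by rewrite ![along s r _]along_sym (along_congl _ hk).
Qed.

Lemma side_far s h : side s (inl (far h)) = ~~ side s (inl h).
Proof.
rewrite /side comp_far; have [r -> rh] := rep_half s h.
rewrite negbK; have := along_or rh; rewrite -along_far farK.
by move=> ->; rewrite negbK.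
Qed.

Lemma side_join s h : side s (inl (join s h)) = ~~ side s (inl h).
Proof. by rewrite -side_far; apply: side_along; apply: along_join. Qed.

Section Lsss.
Variable lam : lsss G.

(** How the direction that the source-sink structure gives to a half-edge compares
    with the orientation of its component chosen by [rep]. *)
Definition theta s p : bool :=
  if p is inl h then into lam h (+) side s p else false.

Lemma into_join s h : into lam (join s h) = ~~ into lam h.
Proof. by rewrite /into over_join hx_join; case: (over h); case: (lam _). Qed.

Lemma into_far h : into lam (far h) = into lam h (+) ~~ cut lam h.
Proof. by rewrite /cut; case: (into lam h); case: (into lam (far h)). Qed.

Lemma lstep_connect s h (b : bool) (u : pt G * bool) :
  connect (lstep lam s) (inl h, b) u ->
  u.1 \in comp s (inl h) /\ u.2 = b (+) (theta s (inl h) (+) theta s u.1).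
Proof.
case/connectP=> l; elim: l h b => [|[[k|f] c] l IHl] h b //=.
  by move=> _ -> /=; rewrite comp_refl addbb addbF.
case/andP=> hk pl ul; have {IHl pl ul}[ul ->] := IHl _ _ pl ul.
move: hk; rewrite /lstep /= => /orP[] /andP[/eqP ek /eqP ->]; rewrite {k}ek in ul *.
  rewrite comp_far in ul; split=> //; set T := theta s u.1.
  rewrite /theta side_far into_far.
  by case: T; case: b; case: (cut _ _); case: (into _ _); case: (side _ _).
rewrite comp_join in ul; split=> //; rewrite /theta side_join into_join.
by rewrite addNb addbN negbK.
Qed.

Lemma connect_lstep s h k (b : bool) :
  connect (adj s) (inl h) (inl k) ->
  exists c, connect (lstep lam s) (inl h, b) (inl k, c).
Proof.
case/connectP=> l; elim: l h b => [|[m|f] l IHl] h b /=.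
- by move=> _ [->]; exists b; apply: connect0.
- case/andP=> hm /IHl{}IHl /IHl.
  case/orP: hm => hm.
    case/(_ (b (+) cut lam h)) => c mc; exists c; apply: connect_trans mc.
    by apply: connect1; rewrite /lstep /= hm !eqxx.
  case/(_ b) => c mc; exists c; apply: connect_trans mc.
  by apply: connect1; rewrite /lstep /= hm !eqxx orbT.
- by [].
Qed.

(** The parity of the number of cut loci is additive along a component: a step
    across a crossing exchanges the strands directed in and out, a step along a
    long arc does so exactly when there is no cut locus on it. *)
Lemma lparE s p q : q \in comp s p -> lpar lam s p q = theta s p (+) theta s q.
Proof.
rewrite /lpar; case: p => [h|f]; last first.
  rewrite comp_free inE => /eqP -> /=; apply/negbTE/negP => /connectP[[|[k c] l]] /=.
    by move=> _ [].
  by [].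
case: q => [k|f]; last by rewrite in_comp connect_adj_sym connect_free.
move=> hk; have /(connect_lstep false)[c hc] : connect (adj s) (inl h) (inl k).
  by rewrite -in_comp.
have [_ /= ec] := lstep_connect hc; apply/idP/idP => [/lstep_connect[_ /= <-] //|].
by move=> e; rewrite ec e in hc.
Qed.

(** The end [o] of the component at the crossing can stand for every half-edge of
    the component there, as soon as the two strands of a component passing
    twice run in the same direction. *)
Lemma lnearE s o g q :
  into lam o -> g = comp s (inl o) -> q \in g ->
  (linked s o (opp o) -> along s o (opp o)) ->
  lnear lam s (hx o) g q = ~~ side s (inl o) (+) theta s q.
Proof.
move=> io gE qg al.
have oE h : hx h = hx o -> inl h \in g -> theta s (inl h) = ~~ side s (inl o).
  have iopp k : into lam (opp k) = into lam k by [].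
  have side_opp : inl (opp o) \in g -> side s (inl (opp o)) = side s (inl o).
    by rewrite gE in_comp_half => /al/side_along.
  move=> /(hx_eq s)/or4P[] /eqP-> hg; rewrite /theta -?join_opp ?into_join ?side_join.
  - by rewrite io.
  - by rewrite iopp io side_opp.
  - by rewrite io /=; case: side.
  - rewrite -join_opp gE -comp_eqP comp_join comp_eqP -gE in hg.
    by rewrite iopp io side_opp //=; case: side.
apply/existsP/idP => [[h /and3P[/eqP hx_h hg]]|lq].
  by rewrite lparE ?oE // -?(GammaP _ hg) // gE Gamma_comp.
exists o; rewrite eqxx {1}gE comp_refl /= lparE -?gE // oE //.
by rewrite gE comp_refl.
Qed.

End Lsss.
End Parity.

(** * Edges of the cube without auxiliary choices *)

(** [r] and [r'] have the same elements, so they have the same inversions with [p]. *)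
Lemma rho_catr p r r' :
  perm_eq r r' -> rho (p ++ r') = rho (p ++ r) * (rho r * rho r').
Proof.
move=> pe; rewrite !rho_cat.
have -> : \prod_(x <- p) (-1) ^+ count (fun y => y < x)%N r'
        = \prod_(x <- p) (-1) ^+ count (fun y => y < x)%N r :> int.
  by apply: eq_bigr => x _; rewrite (seq.permP pe).
by rewrite -[rho r' in LHS]mul1r -(rho_sq r); ring.
Qed.

Section EdgeCore.
Variable G : gauss.
Implicit Types (s t : state G) (h k o : half G) (p q : pt G) (g : {set pt G}).
Implicit Types (a b : {set pt G} -> bool) (x : gX G).

Definition same_off x s t := forall y, y != x -> s y = t y.

Lemma same_offC x s t : same_off x s t -> same_off x t s.
Proof. by move=> e y /e. Qed.

Lemma same_off_away x s t g h :
  same_off x s t -> ~~ passes x g -> inl h \in g -> s (hx h) = t (hx h).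
Proof.
move=> e away hg; apply: e; apply: contraNneq away => <-.
by apply/passesP; exists h.
Qed.

Lemma Gamma_away x s t g :
  same_off x s t -> ~~ passes x g -> (g \in Gamma s) = (g \in Gamma t).
Proof.
move=> e away; apply/idP/idP => gG; apply: (Gamma_agree gG) => h hg.
  exact: same_off_away e away hg.
exact: same_off_away (same_offC e) away hg.
Qed.

Definition pass s o : seq {set pt G} :=
  undup [:: comp s (inl o); comp s (inl (opp o))].

Definition rest x s : seq {set pt G} := [seq g <- enum (Gamma s) | ~~ passes x g].

Lemma passE s o :
  pass s o = if comp s (inl (opp o)) == comp s (inl o) then [:: comp s (inl o)]
             else [:: comp s (inl o); comp s (inl (opp o))].
Proof. by rewrite /pass /= inE eq_sym; case: eqVneq => // ->. Qed.

Lemma mem_pass s o g : g \in Gamma s -> (g \in pass s o) = passes (hx o) g.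
Proof. by move=> gG; rewrite mem_undup (passes_comp _ gG). Qed.

Lemma pass_Gamma s o g : g \in pass s o -> g \in Gamma s.
Proof. by rewrite mem_undup !inE => /orP[] /eqP ->; apply: Gamma_comp. Qed.

Lemma prod_pass s o (F : {set pt G} -> int) :
  \prod_(g in Gamma s) F g =
    \prod_(g <- pass s o) F g * \prod_(g in Gamma s | ~~ passes (hx o) g) F g.
Proof.
rewrite (bigID (passes (hx o))) /=; congr (_ * _).
rewrite big_uniq ?undup_uniq //; apply: eq_bigl => g.
apply/andP/idP => [[gG]|gp]; first by rewrite (mem_pass _ gG).
by have gG := pass_Gamma gp; rewrite -(mem_pass _ gG).
Qed.

Lemma perm_pass s o l : uniq l -> l =i Gamma s ->
  perm_eq l (pass s o ++ [seq g <- l | ~~ passes (hx o) g]).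
Proof.
move=> ul lG; apply: uniq_perm => //.
  rewrite cat_uniq undup_uniq filter_uniq // andbT /=.
  apply/hasPn => g; rewrite mem_filter lG => /andP[away gG].
  by rewrite (mem_pass _ gG).
move=> g; rewrite mem_cat mem_filter lG.
case gG: (g \in Gamma s); first by rewrite (mem_pass _ gG) andbT orbN.
by rewrite andbF orbF; apply/esym/negP => /pass_Gamma; rewrite gG.
Qed.

Definition passing_end s o g : half G := if g == comp s (inl o) then o else opp o.

Lemma passing_endP s o g : g \in pass s o -> g = comp s (inl (passing_end s o g)).
Proof.
rewrite mem_undup !inE /passing_end.
by case: (eqVneq g (comp s (inl o))) => //= _ /eqP.
Qed.

Section Core.
Variable rep : {set pt G} -> option (pt G).
Variable rank : {set pt G} -> nat.

(** The sign of rewriting the labels X in terms of the local orientation at the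
    crossing of [o], for which [o] leads into it. *)
Definition twist s o a : int := \prod_(g <- pass s o)
  (-1) ^+ (a g && side rep s (inl (passing_end s o g))).

Definition core_sign o s t : int :=
  rho (map rank (pass s o ++ rest (hx o) s))
  * rho (map rank (pass t o ++ rest (hx o) s)).

Definition away_eq x s a b : bool :=
  [forall (g | g \in Gamma s), ~~ passes x g ==> (a g == b g)].

(** The coefficient of an edge of the cube in bases that depend neither on the
    orders nor on the star points: the components are ordered by [rank], and the
    label X refers to the orientation of a component that leads into the crossing
    at [rep]. *)
Definition core o s t a b : int :=
  core_sign o s t
  * localV (comp s (inl o)) (comp s (inl (opp o)))
           (comp t (inl o)) (comp t (inl (opp o))) a b
  * twist s o a * twist t o b * (away_eq (hx o) s a b)%:R.

(** The passage from the basis given by the orders and the star points to the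
    one used by [core]. *)
Definition gauge (A : aux G) s a : int :=
  rho (map rank (ord A s))
  * \prod_(g in Gamma s) (-1) ^+ (a g && ~~ theta rep (lam A) s (star A s g)).

Hypothesis repP : forall g p, p \in g -> exists2 q, rep g = Some q & q \in g.
Hypothesis rank_inj : forall s, {in Gamma s &, injective rank}.

Lemma side_away x s t g p :
  same_off x s t -> g \in Gamma s -> ~~ passes x g -> p \in g ->
  side rep s p = side rep t p.
Proof.
move=> e gG away pg; have gt : g \in Gamma t by rewrite -(Gamma_away e away).
rewrite /side -(GammaP gG pg) -(GammaP gt pg).
have [[k|f] -> // kg] := repP pg; case: p pg => // h hg.
rewrite (@along_agree _ s t) // => l kl; apply: same_off_away e away _.
by rewrite (GammaP gG kg) in_comp_half.
Qed.

(** A nonzero local map is a merge or a split; in either case one of the two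
    states has two components at the crossing, and [along_opp] applies to the other. *)
Lemma localV_along o s t a b :
  same_off (hx o) s t -> t (hx o) = ~~ s (hx o) ->
  localV (comp s (inl o)) (comp s (inl (opp o)))
         (comp t (inl o)) (comp t (inl (opp o))) a b != 0 ->
  (linked s o (opp o) -> along s o (opp o))
  /\ (linked t o (opp o) -> along t o (opp o)).
Proof.
rewrite /localV !comp_half_eq => e flip.
case ls: (linked s o (opp o)); case lt: (linked t o (opp o)); rewrite ?eqxx //= => _.
  by split=> // _; apply: along_opp e flip _; rewrite lt.
split=> // _; apply: (along_opp (t := s)); rewrite ?ls ?flip ?negbK //.
exact: same_offC.
Qed.

Lemma map_rank_uniq s l : uniq l -> {subset l <= Gamma s} -> uniq (map rank l).
Proof.
move=> ul sl; rewrite map_inj_in_uniq // => g h /sl gG /sl hG.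
exact: rank_inj gG hG.
Qed.

Lemma perm_rest s t x l : same_off x s t -> uniq l -> l =i Gamma t ->
  perm_eq (rest x s) [seq g <- l | ~~ passes x g].
Proof.
move=> e ul lG; apply: uniq_perm => [||g].
- exact/filter_uniq/enum_uniq.
- exact: filter_uniq.
rewrite [LHS]mem_filter [RHS]mem_filter mem_enum lG; case away: (passes x g) => //=.
by rewrite (Gamma_away e) ?away.
Qed.

(** All factors [rho] of lists of components away from the crossing are squared. *)
Lemma edge_signE (A : aux G) x s t : same_off x s t ->
  edge_sign A s t x
  = rho (map rank (ord A s)) * rho (map rank (ord A t)) * core_sign (odir A x) s t.
Proof.
move=> e; have [xo _] := odirP A x.
have [us sG] := ordP A s; have [ut tG] := ordP A t.
rewrite /edge_sign /core_sign /ord_at /passing /o1 /o2 -/(pass s _) -/(pass t _) /away.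
have pp r l : uniq l -> l =i Gamma r ->
    perm_eq l (pass r (odir A x) ++ [seq g <- l | ~~ passes x g]).
  by have := @perm_pass r (odir A x) l; rewrite xo; apply.
set P := pass s _; set P' := pass t _.
rewrite (@eps_rho _ rank (ord A s)); last first.
- exact: pp.
- by apply: (@map_rank_uniq s _ us) => g; rewrite sG.
rewrite (@eps_rho _ rank (ord A t)); last first.
- exact: pp.
- by apply: (@map_rank_uniq t _ ut) => g; rewrite tG.
have ps : perm_eq (rest x s) [seq g <- ord A s | ~~ passes x g].
  exact: (@perm_rest s s x _ (fun _ _ => erefl) us sG).
have pt : perm_eq (rest x s) [seq g <- ord A t | ~~ passes x g].
  exact: (perm_rest e ut tG).
rewrite (@eps_rho _ rank [seq g <- _ | _]); last first.
- by apply: perm_trans pt; rewrite perm_sym.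
- apply: (@map_rank_uniq s); rewrite ?filter_uniq // => g.
  by rewrite mem_filter sG => /andP[].
rewrite xo !map_cat (rho_catr _ (perm_map rank ps)) (rho_catr _ (perm_map rank pt)).
set r := rho (map rank (rest x s)).
set u := rho (map rank [seq g <- ord A s | _]).
set v := rho (map rank [seq g <- ord A t | _]).
have rr : r * r = 1 by apply: rho_sq.
have uu : u * u = 1 by apply: rho_sq.
have vv : v * v = 1 by apply: rho_sq.
move: (rho _) (rho _) (rho _) (rho _) => i j k l.
transitivity (i * j * (k * l) * (r * r) * (u * u) * (v * v)); first by ring.
by rewrite rr uu vv !mulr1; ring.
Qed.

Lemma edge_coefE (A : aux G) x s t a b :
  same_off x s t -> t x = ~~ s x ->
  edge_sign A s t x * edge_coef A s t x a b
  = gauge A s a * gauge A t b * core (odir A x) s t a b.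
Proof.
move=> e flip; have [xo io] := odirP A x; set o := odir A x in xo io *.
rewrite (edge_signE _ e) /edge_coef /core /o1 /o2 -/o.
set L := localV _ _ _ _ _ _.
have [->|nzL] := eqVneq L 0; first by rewrite !(mul0r, mulr0).
have [als alt] : (linked s o (opp o) -> along s o (opp o))
              /\ (linked t o (opp o) -> along t o (opp o)).
  by apply: localV_along nzL; rewrite xo.
have near r c : (linked r o (opp o) -> along r o (opp o)) ->
    \prod_(g <- pass r o) tauV (lnear (lam A) r x g (star A r g)) (c g) (c g)
    = twist r o c
      * \prod_(g <- pass r o) (-1) ^+ (c g && ~~ theta rep (lam A) r (star A r g)).
  move=> alr; rewrite /twist -big_split /=; apply: eq_big_seq => g gp.
  have gG := pass_Gamma gp; rewrite /tauV eqxx andbC; case: (c g) => //=; rewrite ?mulr1 //.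
  set o' := passing_end r o g; have go' := passing_endP gp.
  have [ho' io' lo'] : [/\ hx o' = x, into (lam A) o'
                         & linked r o' (opp o') -> along r o' (opp o')].
    by rewrite /o' /passing_end; case: ifP => // _; rewrite oppK linked_sym along_sym.
  rewrite -ho' (lnearE repP io' go') ?starP //.
  by rewrite -signr_addb addbN addNb.
rewrite -/(pass s o) -/(pass t o) /passing !near // /gauge.
rewrite (prod_pass s o) (prod_pass t o) xo.
have -> : \prod_(g in Gamma s | ~~ passes x g)
            tauV (lpar (lam A) s (star A s g) (star A t g)) (a g) (b g)
  = \prod_(g in Gamma s | ~~ passes x g)
      (-1) ^+ (a g && ~~ theta rep (lam A) s (star A s g))
    * \prod_(g in Gamma t | ~~ passes x g)
      (-1) ^+ (b g && ~~ theta rep (lam A) t (star A t g))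
    * (away_eq x s a b)%:R.
  case: (boolP (away_eq x s a b)) => [/forall_inP ab|/forall_inPn[g gG]]; last first.
    rewrite negb_imply mulr0 => /andP[away nab].
    by rewrite (bigD1 g) ?gG //= /tauV (negbTE nab) mul0r.
  rewrite mulr1 [X in _ = _ * X](eq_bigl (fun g => (g \in Gamma s) && ~~ passes x g)); last first.
    move=> g /=; case away: (passes x g); rewrite ?andbF //.
    by rewrite (Gamma_away e) ?away.
  rewrite -big_split /=; apply: eq_bigr => g /andP[gG away].
  have gt : g \in Gamma t by rewrite -(Gamma_away e).
  have /implyP/(_ away) abg := ab g gG; rewrite /tauV abg -(eqP abg).
  have ss := starP A gG; have st := starP A gt.
  rewrite (lparE repP) -?(GammaP gG ss) //.
  have -> : theta rep (lam A) s (star A t g) = theta rep (lam A) t (star A t g).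
    rewrite /theta; case est: (star A t g) => [h|//].
    by rewrite (side_away e gG) // -est.
  by rewrite -signr_addb; case: (a g); case: (theta _ _ s _); case: (theta _ _ t _).
move: (core_sign _ _ _) (twist _ _ _) (twist _ _ _) (_%:R) => S T U W.
move: (\prod_(g <- pass s o) _) (\prod_(g in Gamma s | _) _) => P Q.
move: (\prod_(g <- pass t o) _) (\prod_(g in Gamma t | _) _) => P' Q'.
move: (rho _) (rho _) L nzL => r r' L _.
ring.
Qed.

End Core.
End EdgeCore.

(** * Change of the direction at a crossing *)

Section Directions.
Variable G : gauss.
Implicit Types (s t : state G) (h k o : half G) (p q : pt G) (g : {set pt G}).
Implicit Types (a b : {set pt G} -> bool) (x : gX G).
Variable rep : {set pt G} -> option (pt G).
Variable rank : {set pt G} -> nat.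
Hypothesis repP : forall g p, p \in g -> exists2 q, rep g = Some q & q \in g.
Hypothesis rank_inj : forall s, {in Gamma s &, injective rank}.

Lemma twistE s o a : twist rep s o a =
  (-1) ^+ (a (comp s (inl o)) && side rep s (inl o))
  * if linked s o (opp o) then 1
    else (-1) ^+ (a (comp s (inl (opp o))) && side rep s (inl (opp o))).
Proof.
rewrite /twist /passing_end passE -comp_half_eq eq_sym; case: eqVneq => [e|ne].
  by rewrite big_seq1 eqxx mulr1.
by rewrite big_cons big_seq1 eqxx eq_sym (negbTE ne).
Qed.

Lemma linked_opp s o : linked s (opp o) (opp (opp o)) = linked s o (opp o).
Proof. by rewrite oppK linked_sym. Qed.

Lemma twist_opp s o a : (linked s o (opp o) -> along s o (opp o)) ->
  twist rep s (opp o) a = twist rep s o a.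
Proof.
rewrite !twistE linked_opp oppK; case lo: linked => al; last by rewrite mulrC.
rewrite (side_along repP (al isT)) (_ : comp s (inl (opp o)) = comp s (inl o)) //.
by apply/esym/eqP; rewrite comp_half_eq.
Qed.

Lemma twist_join s o a : twist rep s (join s o) a =
  twist rep s o a * ((-1) ^+ a (comp s (inl o))
  * if linked s o (opp o) then 1 else (-1) ^+ a (comp s (inl (opp o)))).
Proof.
rewrite !twistE -join_opp !comp_join !(side_join repP).
have -> : linked s (join s o) (join s (opp o)) = linked s o (opp o).
  by rewrite -!comp_half_eq !comp_join.
have sg (c d : bool) : (-1) ^+ (c && ~~ d) = (-1) ^+ (c && d) * (-1) ^+ c :> int.
  by case: c; case: d.
by rewrite !sg; case: ifP => _; rewrite ?mulr1 // mulrACA.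
Qed.

Lemma rho_pass_opp s o l :
  rho (map rank (pass s (opp o) ++ l))
  = (if linked s o (opp o) then 1 else -1) * rho (map rank (pass s o ++ l)).
Proof.
rewrite !passE oppK -comp_half_eq eq_sym.
case: eqVneq => [->|ne]; first by rewrite mul1r.
rewrite mulN1r; apply: rho_swap; apply: contra ne => /eqP e; apply/eqP.
exact: (rank_inj (Gamma_comp _ _) (Gamma_comp _ _) e).
Qed.

Lemma localVCl (T : eqType) (g1 g2 h1 h2 : T) (a b : T -> bool) :
  localV g1 g2 h1 h2 a b = localV g2 g1 h1 h2 a b.
Proof.
rewrite /localV ![g2 == _]eq_sym /mulV.
by case: eqVneq => [->|_] //=; case: ifP => // _; case: (a g1); case: (a g2).
Qed.

Lemma localVCr (T : eqType) (g1 g2 h1 h2 : T) (a b : T -> bool) :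
  localV g1 g2 h1 h2 a b = localV g1 g2 h2 h1 a b.
Proof.
rewrite /localV ![h2 == _]eq_sym /comulV.
case: (eqVneq h1 h2) => [->|_] //; case: eqP => //= _.
by case: (a g1); case: (b h1); case: (b h2).
Qed.

Lemma linked_xor s o t a b :
  localV (comp s (inl o)) (comp s (inl (opp o)))
         (comp t (inl o)) (comp t (inl (opp o))) a b != 0 ->
  linked s o (opp o) (+) linked t o (opp o).
Proof.
rewrite /localV !comp_half_eq.
by case: (linked s _ _); case: (linked t _ _); rewrite ?eqxx.
Qed.

(** Exactly one of the two states has two components at the crossing, and their
    order is reversed. *)
Lemma core_opp s t o a b :
  same_off (hx o) s t -> t (hx o) = ~~ s (hx o) ->
  core rep rank (opp o) s t a b = - core rep rank o s t a b.
Proof.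
move=> e flip; rewrite /core /core_sign oppK !hx_opp localVCl localVCr.
set L := localV _ _ _ _ _ _.
have [->|nzL] := eqVneq L 0; first by rewrite !(mulr0, mul0r) oppr0.
have [als alt] := localV_along e flip nzL; have := linked_xor nzL.
rewrite !twist_opp // !rho_pass_opp -!mulNr; move=> xor; do 4!congr (_ * _).
rewrite mulrACA -[- rho _]mulN1r -[RHS]mulrA; congr (_ * _).
by case: (linked s _ _) xor; case: (linked t _ _).
Qed.

(** Replacing the half-edge chosen at [x] by the next one on its 0-smoothing arc
    turns the local orientation around.  That changes the sign of the
    comultiplication, which is made up for by the exchange of the two components
    of the target. *)
Lemma core_join s t o a b :
  same_off (hx o) s t -> t (hx o) = ~~ s (hx o) ->
  core rep rank (join s o) s t a b = core rep rank o s t a b.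
Proof.
move=> e flip.
have jt : join s o = join t (opp o).
  by rewrite join_opp; apply: join_flip; rewrite flip negbK.
have passs : pass s (join s o) = pass s o.
  by rewrite !passE -join_opp !comp_join.
have passt : pass t (join s o) = pass t (opp o).
  by rewrite jt !passE -join_opp !comp_join.
have c1 : comp t (inl (join s o)) = comp t (inl (opp o)) by rewrite jt comp_join.
have c2 : comp t (inl (opp (join s o))) = comp t (inl o).
  by rewrite jt -join_opp comp_join oppK.
have c3 : comp s (inl (opp (join s o))) = comp s (inl (opp o)).
  by rewrite -join_opp comp_join.
rewrite /core /core_sign passs passt c1 c2 c3 hx_join comp_join.
rewrite twist_join jt twist_join linked_opp oppK rho_pass_opp localVCr.
set L := localV _ _ _ _ _ _.
have [->|nzL] := eqVneq L 0; first by rewrite !(mulr0, mul0r).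
have [_ alt] := localV_along e flip nzL; rewrite twist_opp //.
have := linked_xor nzL; rewrite {}/L {alt} /localV !comp_half_eq in nzL *.
move: (away_eq _ _ _ _)%:R (twist _ s _ _) (twist _ t _ _) => W T U.
move: (rho _) (rho _) => r r'.
case ls: (linked s _ _) nzL; case lt: (linked t _ _) => //=; rewrite ?eqxx // => nzL _.
  move: nzL; rewrite /comulV.
  by case: (a _); case: (b _); case: (b _) => //= _; rewrite ?expr0 ?expr1; ring.
have -> : comp t (inl (opp o)) = comp t (inl o).
  by apply/esym/eqP; rewrite comp_half_eq.
move: nzL; rewrite /mulV.
by case: (a _); case: (a _); case: (b _) => //= _; rewrite ?expr0 ?expr1; ring.
Qed.

End Directions.

(** * The faces of the cube: the finite computation *)

Section FaceTables.
Local Open Scope nat_scope.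

Section Table.
Variable m : seq nat.

(** The half-edges at the two crossings of a face are numbered from 0 to 7, four for
    each crossing, so that the smoothing at a crossing depends only on its bit in
    [t].  The table [m] lists the partners in a matching of these numbers. *)
Definition table_join (t : bool * bool) : seq nat :=
  (if t.1 then [:: 3; 2; 1; 0] else [:: 2; 3; 0; 1])
  ++ (if t.2 then [:: 7; 6; 5; 4] else [:: 6; 7; 4; 5]).

Definition table_step t k := nth 0 (table_join t) (nth 0 m k).
(** Four steps suffice since each side of a component has at most four of the
    eight half-edges; this is part of what [face_ok] checks. *)
Definition evens t k := traject (table_step t) k 4.
(** A component through the crossings is represented by its least number. *)
Definition least_end t k :=
  find (fun l => (l \in evens t k) || (l \in evens t (nth 0 m k))) (iota 0 8).
Definition table_side t k := least_end t k \notin evens t k.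

Fixpoint inversions (l : seq nat) : bool :=
  if l is x :: l' then odd (count (fun y => y < x) l') (+) inversions l' else false.

Definition set_at (z : bool) (t : bool * bool) := if z then (t.1, true) else (true, t.2).
Definition start_no (z : bool) := if z then 4 else 0.

Definition table_pass t z :=
  let g := least_end t (start_no z) in let g' := least_end t (start_no z).+1 in
  if g' == g then [:: g] else [:: g; g'].
Definition table_rest t z :=
  let p := table_pass t z in [seq k <- iota 0 8 | (least_end t k == k) && (k \notin p)].

Definition table_twist t z (a : seq bool) : bool :=
  (nth false a (start_no z) && table_side t (start_no z))
  (+) if least_end t (start_no z).+1 == least_end t (start_no z) then false
      else nth false a (start_no z).+1 && table_side t (start_no z).+1.

Definition table_local t u z (a b : seq bool) : bool :=
  let i := start_no z in let j := i.+1 in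
  if (least_end t i == least_end t j) && (least_end u i != least_end u j) then
    if nth false a i then nth false b i && nth false b j
    else nth false b i (+) nth false b j
  else if (least_end t i != least_end t j) && (least_end u i == least_end u j) then
    ~~ (nth false a i && nth false a j)
    && (nth false b i == nth false a i || nth false a j)
  else false.

Definition table_away t z (a b : seq bool) : bool :=
  let p := table_pass t z in
  all (fun k => (least_end t k \in p) || (nth false a k == nth false b k)) (iota 0 8).

(** [core] on the part of the states at the two crossings; [None] stands for 0 and
    [Some b] for the sign (-1)^b.  The labels are given at each of the numbers. *)
Definition table_core t z a b : option bool :=
  let u := set_at z t in
  if table_local t u z a b then
    if table_away t z a b then
      let r := table_rest t z in
      Some (inversions (table_pass t z ++ r) (+) inversions (table_pass u z ++ r)
            (+) table_twist t z a (+) table_twist u z b)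
    else None
  else None.

Definition omul (c d : option bool) : option bool :=
  if c is Some e then if d is Some f then Some (e (+) f) else None else None.

Definition least_ends t := [seq k <- iota 0 8 | least_end t k == k].

Fixpoint bitseqs n : seq (seq bool) :=
  if n is n'.+1 then map (cons true) (bitseqs n') ++ map (cons false) (bitseqs n')
  else [:: [::]].

Definition labelings t : seq (seq bool) :=
  let r := least_ends t in
  let idx := [seq index (least_end t k) r | k <- iota 0 8] in
  [seq [seq nth false l i | i <- idx] | l <- bitseqs (size r)].

Definition updates t z (a : seq bool) : seq (seq bool) :=
  let g := least_end t (start_no z) in let g' := least_end t (start_no z).+1 in
  [seq [seq if least_end t k == g then c.1 else if least_end t k == g' then c.2
            else nth false a k | k <- iota 0 8]
   | c <- if g' == g then [:: (true, false); (false, false)]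
          else [:: (true, true); (true, false); (false, true); (false, false)]].

Definition path_terms z (a c : seq bool) : seq (option bool) :=
  let u := set_at z (false, false) in
  [seq omul (table_core (false, false) z a b) (table_core u (~~ z) b c) | b <- updates u z a].

Definition balanced (l : seq (option bool)) :=
  count (pred1 (Some true)) l == count (pred1 (Some false)) l.

(** The first part justifies the length of [evens]; the second one compares the
    two paths of the face for all labels at its ends. *)
Definition face_ok : bool :=
  all (fun t => all (fun k => looping (table_step t) k 4) (iota 0 8))
    [:: (false, false); (true, false); (false, true); (true, true)]
  && all (fun a => all (fun c => balanced (path_terms false a c ++ path_terms true a c))
           (labelings (true, true))) (labelings (false, false)).

End Table.

(** Whether [v] can follow [p] as the next entry of an involution without fixed
    point; it cuts the search down to the 105 matchings. *)
Definition compat (p : seq nat) (v : nat) : bool :=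
  let i := size p in
  [&& v != i, v \notin p, (v < i) ==> (nth 0 p v == i)
    & (i \in p) ==> (v == index i p)].

Fixpoint search (n : nat) (p : seq nat) (C : seq nat -> bool) : bool :=
  if n is n'.+1 then
    all (fun v => if compat p v then search n' (rcons p v) C else true) (iota 0 8)
  else C p.

Lemma all_faces_ok : search 8 [::] face_ok.
Proof. by vm_compute. Qed.

Definition matching (m : seq nat) : Prop :=
  size m = 8 /\
  forall k, k < 8 -> [/\ nth 0 m k < 8, nth 0 m k != k & nth 0 m (nth 0 m k) = k].

Lemma search_sound m n p C :
  matching m -> size p + n = 8 -> p = take (size p) m -> search n p C -> C m.
Proof.
case=> sz mP; elim: n p => [|n IHn] p; rewrite ?addn0 => szp pE.
  by rewrite [in p]pE szp take_oversize ?sz.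
have lt_p : size p < 8 by rewrite -szp addnS ltnS leq_addr.
have [lt_v nv vK] := mP _ lt_p; set i := size p in lt_p lt_v nv vK *.
have nth_p k : k < i -> nth 0 p k = nth 0 m k by rewrite pE => ?; rewrite nth_take.
have inj j k : j < 8 -> k < 8 -> nth 0 m j = nth 0 m k -> j = k.
  by move=> /mP[_ _ jK] /mP[_ _ kK] e; rewrite -jK e kK.
rewrite [search _ _ _]/search -/search => /allP/(_ (nth 0 m i)); rewrite mem_iota lt_v => /(_ isT).
rewrite ifT => [|].
  apply: IHn; rewrite size_rcons ?addSnnS //.
  by rewrite (take_nth 0) ?sz // -pE.
apply/and4P; split=> //.
- apply/(nthP 0) => -[k lt_k]; rewrite nth_p // => /inj e.
  by have := lt_k; rewrite e ?ltnn // (ltn_trans lt_k).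
- by apply/implyP => lt; rewrite nth_p // vK.
apply/implyP => /(nthP 0)[k lt_k]; rewrite nth_p // => e.
have up : uniq p.
  rewrite pE; apply: (subseq_uniq (take_subseq m _)).
  by apply/(uniqP 0) => j l; rewrite !inE sz => lj ll; apply: inj.
have -> : nth 0 m i = k.
  by rewrite /i -e; have [] := mP k (ltn_trans lt_k lt_p).
by rewrite -e -(nth_p k) // index_uniq.
Qed.

Lemma matching_ok m : matching m -> face_ok m.
Proof. by move=> mm; apply: (search_sound mm) all_faces_ok; rewrite // take0. Qed.

Lemma mem_bitseqs l : l \in bitseqs (size l).
Proof.
elim: l => //= b l IHl; rewrite mem_cat.
by case: b; rewrite map_f ?orbT.
Qed.

Lemma mem_labelings m t (f : nat -> bool) :
  (forall k, k < 8 -> least_end m t k \in least_ends m t) ->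
  [seq f (least_end m t k) | k <- iota 0 8] \in labelings m t.
Proof.
move=> rt; apply/mapP; exists (map f (least_ends m t)).
  by rewrite -(size_map f) mem_bitseqs.
rewrite -map_comp; apply/esym/eq_in_map => k; rewrite mem_iota => /rt rk.
by rewrite /ssrfun.comp (nth_map 0) ?index_mem // nth_index.
Qed.

End FaceTables.

(** * The faces of the cube: reduction to the computation *)

(** Entries above all others contribute the same sign to both factors. *)
Lemma rho_prefix n p p' r r' q :
  perm_eq r (r' ++ q) -> all (leq n) q -> all (fun k => k < n)%N (p ++ p' ++ r') ->
  rho (p ++ r) * rho (p' ++ r) = rho (p ++ r') * rho (p' ++ r').
Proof.
rewrite perm_sym => pe /allP nq; rewrite !all_cat => /and3P[lp lp' lr].
have tail l : all (fun k => k < n)%N l -> rho (l ++ q) = rho l * rho q.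
  move=> /allP ln; rewrite rho_cat big1_seq ?mulr1 // => k /andP[_ /ln kn].
  rewrite (_ : count _ q = 0%N) ?expr0 //; apply/eqP; rewrite -leqn0 leqNgt -has_count.
  by apply/hasPn => l' /nq nl'; rewrite -leqNgt; apply: leq_trans (ltnW kn) _.
rewrite !(rho_catr _ pe) !catA.
rewrite (tail (p ++ r')) ?(tail (p' ++ r')) ?all_cat ?lp ?lp' ?lr //.
have := rho_sq (r' ++ q); have := rho_sq r; have := rho_sq q.
move: (rho q) (rho r) (rho (r' ++ q)) (rho (p ++ r')) (rho (p' ++ r')) => u v w i j uu vv ww.
transitivity (i * j * (u * u) * (v * v) * (w * w)); first by ring.
by rewrite uu vv ww !mulr1.
Qed.

Section Face.
Variable G : gauss.
Variables (x y : gX G) (s : state G).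
Hypothesis nxy : x != y.

(** The last bits are shifted by [gpos] on the under-strands, which makes the
    action of [join] the one of [table_join] for crossings of either sign. *)
Definition ends8 : seq (half G) :=
  [:: (x, true, false); (x, true, true); (x, false, gpos x); (x, false, ~~ gpos x);
      (y, true, false); (y, true, true); (y, false, gpos y); (y, false, ~~ gpos y)].

Definition end8 k : half G := nth (x, true, false) ends8 k.

Definition at_face : pred (gX G) := fun z => (z == x) || (z == y).

(** The four states of the face. *)
Definition corner (t : bool * bool) : state G :=
  [ffun z => if z == x then t.1 else if z == y then t.2 else s z].

Definition returns : seq nat := [seq index (first_return at_face s h) ends8 | h <- ends8].

Lemma ends8_uniq : uniq ends8.
Proof.
rewrite /= !inE !xpair_eqE !eqxx /= (negbTE nxy) /=.
by case: (gpos x); case: (gpos y).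
Qed.

Lemma mem_ends8 h : (h \in ends8) = at_face (hx h).
Proof.
case: h => [[z b] e]; rewrite /at_face /hx /= !inE !xpair_eqE.
have [->|_] := eqVneq z x.
  by rewrite (negbTE nxy) /= ?orbF; case: b; case: e; case: (gpos x).
by have [_|_] //= := eqVneq z y; case: b; case: e; case: (gpos y).
Qed.

Lemma end8_in k : (k < 8)%N -> at_face (hx (end8 k)).
Proof. by move=> lt; rewrite -mem_ends8 mem_nth. Qed.

Lemma end8P h : at_face (hx h) -> exists2 k, (k < 8)%N & end8 k = h.
Proof. by rewrite -mem_ends8 => /(nthP (x, true, false)) [k ? ?]; exists k. Qed.

Lemma end8_inj k l : (k < 8)%N -> (l < 8)%N -> end8 k = end8 l -> k = l.
Proof.
by move=> lk ll /eqP; rewrite nth_uniq ?ends8_uniq // => /eqP.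
Qed.

Lemma corner_off t z : ~~ at_face z -> corner t z = s z.
Proof. by rewrite ffunE negb_or => /andP[/negbTE-> /negbTE->]. Qed.

Lemma returnsE k : (k < 8)%N ->
  (nth 0%N returns k < 8)%N /\ end8 (nth 0%N returns k) = first_return at_face s (end8 k).
Proof.
move=> lt; rewrite /returns (nth_map (x, true, false)) // -/(end8 k).
have bk : first_return at_face s (end8 k) \in ends8.
  by rewrite mem_ends8 first_return_in // end8_in.
split; [by rewrite -index_mem in bk | by rewrite /end8 nth_index].
Qed.

Lemma returns_matching : matching returns.
Proof.
split=> // k lt; have [lt' e] := returnsE lt; have [_ e'] := returnsE lt'; split=> //.
  apply/eqP => ek; have := first_return_along s (end8_in lt).
  by rewrite -e ek along_sym far_not_along.
apply: end8_inj => //; first by have [] := returnsE lt'.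
by rewrite e' e first_returnK // end8_in.
Qed.

Lemma table_joinE t k : (k < 8)%N ->
  (nth 0%N (table_join t) k < 8)%N /\ end8 (nth 0%N (table_join t) k) = join (corner t) (end8 k).
Proof.
move=> lt; split; first by case: t => [[] []]; do 8?case: k lt => [|k] lt.
have cx : corner t x = t.1 by rewrite ffunE eqxx.
have cy : corner t y = t.2 by rewrite ffunE eq_sym (negbTE nxy) eqxx.
rewrite joinE; case: t cx cy => [t1 t2] /= cx cy; rewrite /hx /over /onext.
do 8?[case: k lt => [|k] lt //]; rewrite /end8 /ends8 /= ?cx ?cy;
  by case: (t1); case: (t2); case: (gpos x); case: (gpos y).
Qed.

Let m := returns.

Lemma table_stepE t k : (k < 8)%N ->
  (table_step m t k < 8)%N /\
  end8 (table_step m t k) = join (corner t) (first_return at_face (corner t) (end8 k)).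
Proof.
move=> lt; have [lt' e] := returnsE lt; have [lt2 e2] := table_joinE t lt'.
split=> //; rewrite /table_step e2 e (first_return_same (s := s)) ?end8_in // => z.
by move/(corner_off t).
Qed.

Lemma iter_table_stepE t n k : (k < 8)%N ->
  (iter n (table_step m t) k < 8)%N /\
  end8 (iter n (table_step m t) k)
  = iter n (join (corner t) \o first_return at_face (corner t)) (end8 k).
Proof.
move=> lt; elim: n => [|n [lt' e]] //=.
by have [lt2 ->] := table_stepE t lt'; rewrite e.
Qed.

(** The first return map is the matching, and the four steps of [evens] suffice by
    [matching_ok]. *)
Lemma evensP t k l : (k < 8)%N -> (l < 8)%N ->
  along (corner t) (end8 k) (end8 l) = (l \in evens m t k).
Proof.
move=> lk ll; have ok := matching_ok returns_matching.
have lo : looping (table_step m t) k 4.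
  case/andP: ok => /allP/(_ t) ok _.
  have /ok/allP/(_ k) : t \in [:: (false, false); (true, false); (false, true); (true, true)].
    by case: t {ok} => [[] []].
  by rewrite mem_iota; apply.
apply/(@along_returnP G at_face _ _ _ (end8_in lk) (end8_in ll))/idP => [[n e]|].
  have [lt' e'] := iter_table_stepE t n lk.
  rewrite -(end8_inj lt' ll) ?e' //; exact/loopingP.
case/trajectP=> n _ ->; exists n.
by have [_ ->] := iter_table_stepE t n lk.
Qed.

Lemma return_linked t k l : (k < 8)%N -> (l < 8)%N ->
  along (corner t) (far (end8 k)) (end8 l) = (l \in evens m t (nth 0%N m k)).
Proof.
move=> lk ll; have [lk' e] := returnsE lk; rewrite -evensP //; apply: along_congl.
rewrite e -(first_return_same (s := s) (t := corner t)) ?end8_in ?first_return_along ?end8_in //.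
by move=> z /(corner_off t).
Qed.

Lemma linkedP t k l : (k < 8)%N -> (l < 8)%N ->
  linked (corner t) (end8 k) (end8 l)
  = (l \in evens m t k) || (l \in evens m t (nth 0%N m k)).
Proof. by move=> lk ll; rewrite /linked evensP // return_linked. Qed.

Definition comp_at t k : {set pt G} := comp (corner t) (inl (end8 k)).

Definition first_end (g : {set pt G}) : nat := find (fun h => inl h \in g) ends8.

(** Components through the two crossings come first, ordered by the least number
    among their half-edges there, so that the signs of the face do not depend on the
    other components. *)
Definition face_rank (g : {set pt G}) : nat :=
  if (first_end g < 8)%N then first_end g else (8 + enum_rank g)%N.

Definition face_rep (g : {set pt G}) : option (pt G) :=
  if (first_end g < 8)%N then Some (inl (end8 (first_end g))) else [pick p in g].

Lemma first_endP g : (first_end g < 8)%N -> inl (end8 (first_end g)) \in g.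
Proof.
by rewrite -[8%N]/(size ends8) -has_find => /(nth_find (x, true, false)).
Qed.

Lemma face_repP (g : {set pt G}) p :
  p \in g -> exists2 q, face_rep g = Some q & q \in g.
Proof.
rewrite /face_rep; case: ifP => [/first_endP g1 _|_ pg]; first by eexists.
by case: pickP => [q qg|/(_ p)]; [exists q | rewrite pg].
Qed.

Lemma face_rank_inj t : {in Gamma t &, injective face_rank}.
Proof.
move=> g h gG hG; rewrite /face_rank.
case: ifP => lg; case: ifP => lh e.
- have := first_endP lg; rewrite e => eg.
  exact: etrans (GammaP gG eg) (esym (GammaP hG (first_endP lh))).
- by move: lg; rewrite e.
- by move: lh; rewrite -e.
- by apply/enum_rank_inj/val_inj/(addnI e).
Qed.

Lemma first_end_comp_at t k : (k < 8)%N -> first_end (comp_at t k) = least_end m t k.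
Proof.
move=> lk; rewrite /first_end (_ : ends8 = map end8 (iota 0 8)) // find_map.
apply: eq_in_find => l; rewrite mem_iota => ll /=.
by rewrite in_comp_half linkedP.
Qed.

Lemma least_end_lt t k : (k < 8)%N -> (least_end m t k < 8)%N.
Proof.
move=> lk; rewrite -(size_iota 0 8) -has_find; apply/hasP; exists k.
  by rewrite mem_iota.
by rewrite mem_head.
Qed.

Lemma face_rank_comp_at t k : (k < 8)%N -> face_rank (comp_at t k) = least_end m t k.
Proof. by move=> lk; rewrite /face_rank first_end_comp_at // least_end_lt. Qed.

Lemma face_rep_comp_at t k : (k < 8)%N ->
  face_rep (comp_at t k) = Some (inl (end8 (least_end m t k))).
Proof. by move=> lk; rewrite /face_rep first_end_comp_at // least_end_lt. Qed.

Lemma comp_at_eq t k l : (k < 8)%N -> (l < 8)%N ->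
  (comp_at t k == comp_at t l) = (least_end m t k == least_end m t l).
Proof.
move=> lk ll; rewrite -!face_rank_comp_at //; apply/eqP/eqP => [-> //|].
by apply: face_rank_inj; apply: Gamma_comp.
Qed.

Lemma comp_at_least_end t k : (k < 8)%N -> comp_at t (least_end m t k) = comp_at t k.
Proof.
move=> lk; apply/eqP; rewrite comp_half_eq linked_sym -in_comp_half -/(comp_at t k).
have := first_endP (g := comp_at t k); rewrite first_end_comp_at //; apply.
exact: least_end_lt.
Qed.

Lemma least_end_idem t k : (k < 8)%N -> least_end m t (least_end m t k) = least_end m t k.
Proof.
by move=> lk; apply/eqP; rewrite -comp_at_eq ?least_end_lt // comp_at_least_end.
Qed.

Lemma side_table t k : (k < 8)%N ->
  side face_rep (corner t) (inl (end8 k)) = table_side m t k.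
Proof.
move=> lk; rewrite /side -/(comp_at t k) face_rep_comp_at // along_sym.
by rewrite evensP ?least_end_lt.
Qed.

Definition crossing (z : bool) : gX G := if z then y else x.

Definition start z : half G := (crossing z, true, false).

Lemma startE z : start z = end8 (start_no z). Proof. by case: z. Qed.

Lemma opp_startE z : opp (start z) = end8 (start_no z).+1. Proof. by case: z. Qed.

Lemma start_no_lt z : ((start_no z).+1 < 8)%N. Proof. by case: z. Qed.

Let start_no_lt0 z : (start_no z < 8)%N. Proof. by case: z. Qed.
Hint Resolve start_no_lt start_no_lt0 : core.

Lemma at_faceE z w : at_face w = (w == crossing z) || (w == crossing (~~ z)).
Proof. by case: z => //=; rewrite orbC. Qed.

Lemma corner_same z t : same_off (crossing z) (corner t) (corner (set_at z t)).
Proof. by case: z => w; rewrite /= !ffunE => /negbTE -> //=; rewrite if_same. Qed.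

Definition on_ends t (a : {set pt G} -> bool) : seq bool :=
  [seq a (comp_at t k) | k <- iota 0 8].

Lemma nth_on_ends t a k : (k < 8)%N -> nth false (on_ends t a) k = a (comp_at t k).
Proof. by move=> lk; rewrite (nth_map 0%N) ?size_iota // nth_iota. Qed.

Definition val_opt (c : option bool) : int := if c is Some b then (-1) ^+ b else 0.

(** Components away from both crossings keep their labels along the two paths. *)
Definition quiet_eq (a b : {set pt G} -> bool) : bool :=
  [forall (g | g \in Gamma s), ~~ passes x g && ~~ passes y g ==> (a g == b g)].

Lemma face_rank_pass t z : map face_rank (pass (corner t) (start z)) = table_pass m t z.
Proof.
rewrite passE opp_startE startE -!/(comp_at t _) comp_at_eq // /table_pass.
by case: ifP => _ /=; rewrite !face_rank_comp_at.
Qed.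

Lemma comp_at_Gamma t k : comp_at t k \in Gamma (corner t). Proof. exact: Gamma_comp. Qed.

Lemma passes_least_end t z k : (k < 8)%N ->
  passes (crossing z) (comp_at t k) = (least_end m t k \in table_pass m t z).
Proof.
move=> lk; rewrite -[crossing z]/(hx (start z)) -(@mem_pass _ (corner t)) ?comp_at_Gamma //.
rewrite -face_rank_pass -face_rank_comp_at //; apply/idP/idP => [/(map_f face_rank) //|].
case/mapP=> g gp /(@face_rank_inj (corner t)) -> //; first exact: comp_at_Gamma.
exact: pass_Gamma gp.
Qed.

Lemma comp_at_away t z k : (k < 8)%N -> least_end m t k \notin table_pass m t z ->
  comp_at (set_at z t) k = comp_at t k.
Proof.
move=> lk; rewrite -passes_least_end // => away; apply/esym.
apply: (@GammaP _ (corner (set_at z t))); last exact: comp_refl.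
by rewrite -(Gamma_away (@corner_same z t)) ?comp_at_Gamma.
Qed.

Lemma passing_comp_at t z g : g \in Gamma (corner t) -> passes (crossing z) g ->
  exists2 k, (k < 8)%N & g = comp_at t k.
Proof.
move=> gG /passesP[h hx_h hg].
have /end8P[k lk e] : at_face (hx h) by rewrite (at_faceE z) hx_h eqxx.
by exists k => //; rewrite /comp_at e; apply: GammaP.
Qed.

Lemma quiet_Gamma t g :
  ~~ passes x g -> ~~ passes y g -> (g \in Gamma (corner t)) = (g \in Gamma s).
Proof.
move=> nx ny; have off h : inl h \in g -> ~~ at_face (hx h).
  by move=> hg; apply/norP; split; [apply: contra nx|apply: contra ny];
    move/eqP=> <-; apply/passesP; exists h.
by apply/idP/idP => gG; apply: (Gamma_agree gG) => h /off /(corner_off t) ->.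
Qed.

Lemma quiet_crossing z g :
  ~~ passes (crossing z) g && ~~ passes (crossing (~~ z)) g
  = ~~ passes x g && ~~ passes y g.
Proof. by case: z => //; rewrite andbC. Qed.

Lemma away_quiet t z a b :
  away_eq (crossing z) (corner t) a b
  = table_away m t z (on_ends t a) (on_ends (set_at z t) b) && quiet_eq a b.
Proof.
apply/idP/andP => [/forall_inP ab|[/allP sab /forall_inP qab]].
  split.
    apply/allP => k; rewrite mem_iota => lk; rewrite !nth_on_ends //.
    case: (boolP (least_end m t k \in _)) => //= away.
    have /implyP := ab _ (comp_at_Gamma t k); rewrite passes_least_end // => /(_ away).
    by rewrite comp_at_away.
  apply/forall_inP => g gG; apply/implyP => q; have /andP[nx ny] := q.
  have := ab g; rewrite (quiet_Gamma t) // => /(_ gG)/implyP; apply.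
  by move: q; rewrite -(quiet_crossing z) => /andP[].
apply/forall_inP => g gG; apply/implyP => nz.
case: (boolP (passes (crossing (~~ z)) g)) => [/(passing_comp_at gG)[k lk e]|nz'].
  have := sab k; rewrite mem_iota !nth_on_ends // => /(_ lk).
  rewrite -passes_least_end // -e (negbTE nz) /= comp_at_away -?e //.
  by rewrite -passes_least_end // -e.
have q : ~~ passes x g && ~~ passes y g by rewrite -(quiet_crossing z) nz.
have /andP[nx ny] := q.
by have := qab g; rewrite -(quiet_Gamma t) // => /(_ gG)/implyP; apply.
Qed.
Lemma rho_inv l : rho l = (-1) ^+ inversions l.
Proof. by elim: l => //= n l ->; rewrite signr_addb signr_odd. Qed.

Lemma perm_table_rest t z :
  perm_eq (map face_rank (rest (crossing z) (corner t)))
    (table_rest m t z ++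
     map face_rank [seq g <- rest (crossing z) (corner t) | ~~ passes (crossing (~~ z)) g]).
Proof.
set r := rest _ _.
have rP g : g \in r = (~~ passes (crossing z) g) && (g \in Gamma (corner t)).
  by rewrite mem_filter mem_enum.
have rG : {subset r <= Gamma (corner t)} by move=> g; rewrite rP => /andP[].
have ur : uniq r by exact/filter_uniq/enum_uniq.
have pr : perm_eq r ([seq g <- r | passes (crossing (~~ z)) g]
                     ++ [seq g <- r | ~~ passes (crossing (~~ z)) g]).
  by rewrite perm_sym; apply/permPl/perm_filterC.
rewrite (permPl (perm_map face_rank pr)) map_cat perm_cat2r; apply: uniq_perm.
- apply: (@map_rank_uniq _ _ face_rank_inj (corner t)); first exact: filter_uniq.
  by move=> g; rewrite mem_filter => /andP[_ /rG].
- exact/filter_uniq/iota_uniq.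
move=> k; rewrite mem_filter mem_iota; apply/mapP/idP => [[g]|].
  rewrite mem_filter rP => /andP[gy /andP[nz gG]] ->.
  have [l ll e] := passing_comp_at gG gy; rewrite e face_rank_comp_at // least_end_idem // eqxx.
  by rewrite least_end_lt // -passes_least_end // -e nz.
case/andP=> /andP[/eqP rk nk] lk; exists (comp_at t k); last by rewrite face_rank_comp_at.
rewrite mem_filter rP comp_at_Gamma andbT.
have nz : ~~ passes (crossing z) (comp_at t k) by rewrite passes_least_end // rk.
rewrite nz andbT; have := end8_in lk; rewrite (at_faceE z) => /orP[]/eqP hk.
  by case/negP: nz; apply/passesP; exists (end8 k) => //; apply: comp_refl.
by apply/passesP; exists (end8 k) => //; apply: comp_refl.
Qed.

Lemma face_rank_quiet t z g :
  g \in [seq g <- rest (crossing z) (corner t) | ~~ passes (crossing (~~ z)) g] ->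
  (8 <= face_rank g)%N.
Proof.
rewrite !mem_filter => /and3P[ny nz _]; rewrite /face_rank.
case: (ltnP (first_end g) 8) => [g8|_]; last exact: leq_addr.
have := end8_in g8; rewrite (at_faceE z) => /orP[]/eqP hk.
  by case/negP: nz; apply/passesP; exists (end8 (first_end g)) => //; apply: first_endP.
by case/negP: ny; apply/passesP; exists (end8 (first_end g)) => //; apply: first_endP.
Qed.

Lemma table_pass_lt t z k : k \in table_pass m t z -> (k < 8)%N.
Proof.
by rewrite /table_pass; case: ifP => _; rewrite !inE; [|case/orP]; move/eqP->; apply: least_end_lt.
Qed.

Lemma core_sign_inv t z :
  core_sign face_rank (start z) (corner t) (corner (set_at z t))
  = (-1) ^+ (inversions (table_pass m t z ++ table_rest m t z)
             (+) inversions (table_pass m (set_at z t) z ++ table_rest m t z)).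
Proof.
rewrite /core_sign !map_cat !face_rank_pass -[hx _]/(crossing z).
rewrite (rho_prefix (n := 8) (perm_table_rest t z)) ?rho_inv ?signr_addb //.
- apply/allP => l /mapP[g gq ->]; exact: face_rank_quiet gq.
- rewrite !all_cat; apply/and3P; split; apply/allP => k; try exact: table_pass_lt.
  by rewrite mem_filter mem_iota => /andP[_].
Qed.

Lemma localV_table t z a b :
  localV (comp (corner t) (inl (start z))) (comp (corner t) (inl (opp (start z))))
    (comp (corner (set_at z t)) (inl (start z)))
    (comp (corner (set_at z t)) (inl (opp (start z)))) a b
  = (table_local m t (set_at z t) z (on_ends t a) (on_ends (set_at z t) b))%:R.
Proof.
rewrite opp_startE startE -!/(comp_at _ _) /localV /table_local !comp_at_eq // !nth_on_ends //.
by case: ifP => _; [rewrite /comulV; case: (a _) | case: ifP].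
Qed.

Lemma twist_table t z a :
  twist face_rep (corner t) (start z) a = (-1) ^+ table_twist m t z (on_ends t a).
Proof.
rewrite twistE opp_startE startE -comp_half_eq -!/(comp_at _ _) comp_at_eq // eq_sym.
rewrite /table_twist !nth_on_ends // !side_table // signr_addb.
by case: ifP.
Qed.

Lemma core_table t z a b :
  core face_rep face_rank (start z) (corner t) (corner (set_at z t)) a b
  = val_opt (table_core m t z (on_ends t a) (on_ends (set_at z t) b)) * (quiet_eq a b)%:R.
Proof.
rewrite /core core_sign_inv localV_table !twist_table away_quiet /table_core.
case: (table_local _ _ _ _ _ _); last by rewrite !(mul0r, mulr0).
case: (table_away _ _ _ _ _); last by rewrite mul0r mulr0.
by rewrite mulr1 /= -!signr_addb.
Qed.
Lemma sum_balanced l : balanced l -> \sum_(c <- l) val_opt c = 0.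
Proof.
suff -> : \sum_(c <- l) val_opt c
    = (count (pred1 (Some false)) l)%:R - (count (pred1 (Some true)) l)%:R.
  by move/eqP->; rewrite subrr.
elim: l => [|c l IHl]; first by rewrite big_nil subrr.
rewrite big_cons IHl /= !natrD opprD addrACA; congr (_ + _).
by case: c => [[]|].
Qed.

Lemma val_omul c d : val_opt (omul c d) = val_opt c * val_opt d.
Proof. by case: c d => [c|] [d|]; rewrite ?mul0r ?mulr0 //= signr_addb. Qed.

(** The only labellings of an intermediate state that an edge can reach from [a];
    the labels of the components at the crossing are listed in [c]. *)
Definition update t o (a : {set pt G} -> bool) (c : bool * bool) (g : {set pt G}) :=
  if g == comp t (inl o) then c.1
  else if g == comp t (inl (opp o)) then c.2 else a g.

(** The label pairs for [update]; if there is one component at the crossing, it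
    takes the first label, and the second one is fixed. *)
Definition choices t (o : half G) : seq (bool * bool) :=
  if linked t o (opp o) then [:: (true, false); (false, false)]
  else [:: (true, true); (true, false); (false, true); (false, false)].

Lemma comp_at_away_after t z k : (k < 8)%N ->
  least_end m (set_at z t) k \notin table_pass m (set_at z t) z ->
  comp_at (set_at z t) k = comp_at t k.
Proof.
move=> lk; rewrite -passes_least_end // => away.
apply: (@GammaP _ (corner t)); last exact: comp_refl.
by rewrite (Gamma_away (@corner_same z t)) ?comp_at_Gamma.
Qed.

Lemma table_passE t z k : (k \in table_pass m t z)
  = (k == least_end m t (start_no z)) || (k == least_end m t (start_no z).+1).
Proof. by rewrite /table_pass; case: eqP => [->|_]; rewrite !inE ?orbb. Qed.

Lemma on_ends_update t z a c :
  on_ends (set_at z t) (update (corner (set_at z t)) (start z) a c)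
  = [seq if least_end m (set_at z t) k == least_end m (set_at z t) (start_no z) then c.1
         else if least_end m (set_at z t) k == least_end m (set_at z t) (start_no z).+1 then c.2
         else nth false (on_ends t a) k | k <- iota 0 8].
Proof.
apply/eq_in_map => k; rewrite mem_iota => lk; rewrite /update opp_startE startE.
rewrite -!/(comp_at _ _) !comp_at_eq //; case: ifP => // ne1; case: ifP => // ne2.
by rewrite nth_on_ends // comp_at_away_after // table_passE ne1 ne2.
Qed.

Lemma quiet_update u z a c g :
  ~~ passes x g && ~~ passes y g -> update (corner u) (start z) a c g = a g.
Proof.
rewrite -(quiet_crossing z) /update => /andP[nz _].
rewrite !ifF //; apply: contraNF nz => /eqP ->; apply/passesP.
  by exists (opp (start z)) => //; apply: comp_refl.
by exists (start z) => //; apply: comp_refl.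
Qed.

Lemma quiet_eq_update u z a b c :
  (quiet_eq a (update (corner u) (start z) a c))%:R
  * (quiet_eq (update (corner u) (start z) a c) b)%:R = (quiet_eq a b)%:R :> int.
Proof.
rewrite (_ : quiet_eq a _ = true); last first.
  by apply/forall_inP => g _; apply/implyP => q; rewrite quiet_update.
rewrite mul1r; congr (nat_of_bool _)%:R; apply: eq_forallb_in => g _.
by apply: implyb_id2l => q; rewrite quiet_update.
Qed.

Lemma on_ends_labelings t a : on_ends t a \in labelings m t.
Proof.
rewrite /on_ends.
have -> : [seq a (comp_at t k) | k <- iota 0 8]
        = [seq (fun r => a (comp_at t r)) (least_end m t k) | k <- iota 0 8].
  by apply/eq_in_map => k; rewrite mem_iota => lk; rewrite comp_at_least_end.
apply: (@mem_labelings m t (fun r => a (comp_at t r))) => k lk.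
rewrite mem_filter mem_iota least_end_idem // eqxx.
exact: least_end_lt.
Qed.

Definition bottom := (false, false).
Definition top := (true, true).

(** The sum runs over the intermediate labellings that the first edge can reach. *)
Lemma face_path z a b :
  let u := set_at z bottom in
  \sum_(c <- choices (corner u) (start z))
     core face_rep face_rank (start z) (corner bottom) (corner u) a
       (update (corner u) (start z) a c)
     * core face_rep face_rank (start (~~ z)) (corner u) (corner top)
       (update (corner u) (start z) a c) b
  = (\sum_(e <- path_terms m z (on_ends bottom a) (on_ends top b)) val_opt e)
    * (quiet_eq a b)%:R.
Proof.
move=> u; have ut : set_at (~~ z) u = top by rewrite /u; case: (z).
rewrite /path_terms /updates; cbv zeta; rewrite !big_map mulr_suml /choices -/u.
rewrite opp_startE startE -comp_half_eq -!/(comp_at _ _) comp_at_eq // eq_sym.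
have core2 := core_table u (~~ z); rewrite ut in core2.
apply: eq_bigr => c _; rewrite -startE (core_table bottom z) core2 val_omul.
rewrite -on_ends_update -(quiet_eq_update u z a b c).
by rewrite mulrACA.
Qed.

Lemma face_core a b :
  \sum_(z : bool) \sum_(c <- choices (corner (set_at z bottom)) (start z))
     core face_rep face_rank (start z) (corner bottom) (corner (set_at z bottom)) a
       (update (corner (set_at z bottom)) (start z) a c)
     * core face_rep face_rank (start (~~ z)) (corner (set_at z bottom)) (corner top)
       (update (corner (set_at z bottom)) (start z) a c) b = 0.
Proof.
rewrite (eq_bigr _ (fun z _ => face_path z a b)) -mulr_suml big_bool /=.
rewrite addrC -big_cat sum_balanced ?mul0r //=.
have /andP[_ /allP] := matching_ok returns_matching.
by move/(_ _ (on_ends_labelings bottom a))/allP/(_ _ (on_ends_labelings top b)).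
Qed.

End Face.

(** * The square of the differential *)

Section Square.
Variable G : gauss.
Implicit Types (s t : state G) (h k o : half G) (p q : pt G) (g : {set pt G}).
Implicit Types (a b : {set pt G} -> bool) (x y : gX G).

Lemma edge_off x s t : edge x s t -> same_off x s t.
Proof. by case/andP=> _ /eqP -> y /negbTE ny; rewrite ffunE ny. Qed.

Lemma edge_flip x s t : edge x s t -> t x = ~~ s x.
Proof. by case/andP=> /negbTE -> /eqP ->; rewrite ffunE eqxx. Qed.

(** A direction [o'] at the crossing of [o] is [o] or its neighbour on the
    0-smoothing arc, or the opposite of one of these. *)
Definition dirsign o o' : int :=
  if (o' == o) || (o' == join [ffun=> false] o) then 1 else -1.

Lemma dirsign_sq o o' : dirsign o o' * dirsign o o' = 1.
Proof. by rewrite /dirsign; case: ifP; rewrite ?mulrNN mulr1. Qed.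

Section Core.
Variable rep : {set pt G} -> option (pt G).
Variable rank : {set pt G} -> nat.
Hypothesis repP : forall g p, p \in g -> exists2 q, rep g = Some q & q \in g.
Hypothesis rank_inj : forall s, {in Gamma s &, injective rank}.

(** From [core_opp] and [core_join]: [opp] and [join s] together take [o] to every
    half-edge at its crossing.  The sign does not depend on the states. *)
Lemma core_dir o o' s t a b :
  hx o' = hx o -> edge (hx o) s t ->
  core rep rank o' s t a b = dirsign o o' * core rep rank o s t a b.
Proof.
move=> e ed; have off := edge_off ed; have flip := edge_flip ed.
have j0 : join [ffun=> false] o = join s o.
  by apply: join_same; rewrite ffunE; case/andP: ed => /negbTE.
have opp_neq k : (opp k == k) = false.
  by apply/negP => /eqP/(congr1 (@onext G)); rewrite /opp /onext /=; case: k.2.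
have over_neq k l : over k != over l -> (k == l) = false.
  by apply: contraNF => /eqP ->.
rewrite /dirsign j0; case/or4P: (hx_eq s e) => /eqP ->.
- by rewrite eqxx mul1r.
- rewrite opp_neq over_neq; last first.
    by rewrite over_join -[over (opp o)]/(over o); case: (over o).
  by rewrite mulN1r core_opp.
- by rewrite eqxx orbT mul1r core_join.
rewrite opp_neq over_neq; last first.
  by rewrite -[over (opp _)]/(over (join s o)) over_join; case: (over o).
by rewrite mulN1r core_opp ?hx_join // core_join.
Qed.

Lemma gauge_sq (A : aux G) s a : gauge rep rank A s a * gauge rep rank A s a = 1.
Proof.
rewrite /gauge mulrACA rho_sq mul1r -big_split /=.
by apply: big1 => g _; rewrite -expr2 sqrr_sign.
Qed.

Lemma core_ext o s t a a' b b' :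
  {in Gamma s, a =1 a'} -> {in Gamma t, b =1 b'} -> same_off (hx o) s t ->
  core rep rank o s t a b = core rep rank o s t a' b'.
Proof.
move=> ea eb off; rewrite /core /localV !twistE /mulV /comulV.
rewrite !ea ?Gamma_comp // !eb ?Gamma_comp //; congr (_ * (nat_of_bool _)%:R).
apply: eq_forallb_in => g gG; apply: implyb_id2l => away.
by rewrite ea // eb // -(Gamma_away off).
Qed.

Lemma gauge_ext (A : aux G) s a a' :
  {in Gamma s, a =1 a'} -> gauge rep rank A s a = gauge rep rank A s a'.
Proof. by move=> e; congr (_ * _); apply: eq_bigr => g gG; rewrite e. Qed.

End Core.

Section Labels.
Variable A : aux G.

Definition with_labels t b : ckh_gen A :=
  existT _ t [tuple b (nth set0 (ord A t) i) | i < size (ord A t)].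

Lemma label_with t b g : g \in Gamma t -> label (with_labels t b) g = b g.
Proof.
have [ut tG] := ordP A t; rewrite -tG => gt; rewrite /label.
have lt : (index g (ord A t) < size (ord A t))%N by rewrite index_mem.
transitivity (tnth [tuple b (nth set0 (ord A t) i) | i < size (ord A t)] (Ordinal lt)).
  by rewrite (tnth_nth false).
by rewrite tnth_mktuple /= nth_index.
Qed.

Lemma with_label (w : ckh_gen A) : with_labels (tag w) (label w) = w.
Proof.
case: w => t l; rewrite /with_labels /label /=; congr existT; apply: eq_from_tnth => i.
by rewrite tnth_mktuple (tnth_nth false) index_uniq //; have [] := ordP A t.
Qed.

Lemma with_labelsP t b (w : ckh_gen A) :
  reflect (tag w = t /\ {in Gamma t, label w =1 b}) (with_labels t b == w).
Proof.
apply: (iffP eqP) => [<-|[<- e]]; first by split=> // g; apply: label_with.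
rewrite -{2}(with_label w); congr existT; apply: eq_from_tnth => i.
rewrite !tnth_mktuple e //; have [_ <-] := ordP A (tag w).
exact: mem_nth.
Qed.

Lemma update_with t o a c (w : ckh_gen A) : tag w = t ->
  {in Gamma t, forall g, ~~ passes (hx o) g -> label w g = a g} ->
  (with_labels t (update t o a c) == w)
  = (c.1 == label w (comp t (inl o)))
    && (linked t o (opp o) || (c.2 == label w (comp t (inl (opp o))))).
Proof.
move=> tw wa; rewrite /update -comp_half_eq; apply/with_labelsP/andP => [[_ e]|[/eqP e1 e2]].
  have := e _ (Gamma_comp t (inl o)); rewrite eqxx => ->; split=> //.
  have := e _ (Gamma_comp t (inl (opp o))); rewrite eqxx eq_sym.
  by case: eqP => //= _ ->.
split=> // g gG; case: eqVneq => [->|n1]; first by rewrite e1.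
case: eqVneq => [e3|n2].
  by move: e2; rewrite -e3 eq_sym (negbTE n1) => /eqP ->.
by apply: wa; rewrite // (passes_comp o gG) // !inE negb_or n1.
Qed.

(** Only labellings that agree with [a] away from the crossing contribute. *)
Lemma sum_labels t o a (F : ({set pt G} -> bool) -> int) :
  (forall b b', {in Gamma t, b =1 b'} -> F b = F b') ->
  (forall b, F b != 0 -> {in Gamma t, forall g, ~~ passes (hx o) g -> b g = a g}) ->
  \sum_(w : ckh_gen A | tag w == t) F (label w)
  = \sum_(c <- choices t o) F (update t o a c).
Proof.
move=> Fext F0; pose up c := with_labels t (update t o a c).
transitivity (\sum_(c <- choices t o)
                \sum_(w | (tag w == t) && (up c == w)) F (label w)); last first.
  apply: eq_bigr => c _; rewrite (big_pred1 (up c)) => [|w].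
    by apply: Fext => g; apply: label_with.
  by apply/andP/eqP => [[_ /eqP] | ->].
rewrite (exchange_big_dep (fun w : ckh_gen A => tag w == t)) /=; last first.
  by move=> c w _ /andP[].
apply: eq_bigr => w /eqP tw.
have [F0w|/F0 wa] := eqVneq (F (label w)) 0; first by rewrite F0w big1_eq.
under eq_bigl => c do rewrite tw eqxx (update_with c tw wa).
rewrite /choices; case: (linked _ _ _) => /=.
  rewrite !big_cons big_nil /=; case: (label w _) => /=; by rewrite ?addr0 ?add0r.
rewrite !big_cons big_nil /=.
by case: (label w _); case: (label w _); rewrite /= ?addr0 ?add0r.
Qed.

Definition entry x (u w : ckh_gen A) : int :=
  edge_sign A (tag u) (tag w) x * edge_coef A (tag u) (tag w) x (label u) (label w).

Lemma entryE rep rank (repP : forall g p, p \in g -> exists2 q, rep g = Some q & q \in g)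
    (rank_inj : forall s, {in Gamma s &, injective rank}) x o u w :
  hx o = x -> edge x (tag u) (tag w) ->
  entry x u w = dirsign o (odir A x)
    * (gauge rep rank A (tag u) (label u) * gauge rep rank A (tag w) (label w))
    * core rep rank o (tag u) (tag w) (label u) (label w).
Proof.
move=> xo ed; have [xd _] := odirP A x.
rewrite /entry (edge_coefE repP rank_inj _ _ _ (edge_off ed) (edge_flip ed)).
rewrite (core_dir repP rank_inj (o := o)) ?xd ?xo //.
by rewrite [dirsign _ _ * (_ * _)]mulrC -[RHS]mulrA.
Qed.

End Labels.

Lemma edge_edge x y s t v :
  edge x s t && edge y t v
  = [&& x != y, ~~ s x, ~~ s y, t == corner x y s (true, false)
      & v == corner x y s (true, true)].
Proof.
apply/andP/and5P => [[/andP[sx /eqP tE] /andP[ty /eqP vE]]|[nxy sx sy /eqP tE /eqP vE]].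
  have nxy : x != y by apply: contraNneq ty => <-; rewrite tE ffunE eqxx.
  have sy : ~~ s y by move: ty; rewrite tE ffunE negb_or => /andP[].
  split=> //; apply/eqP.
    rewrite tE; apply/ffunP => z; rewrite !ffunE; case: eqVneq => //= _.
    by case: eqVneq => //= ->; apply: negbTE.
  rewrite vE tE; apply/ffunP => z; rewrite !ffunE.
  by case: eqVneq => //=; case: eqVneq.
split; apply/andP; split=> //; rewrite ?tE ?vE.
- apply/eqP/ffunP => z; rewrite !ffunE; case: eqVneq => //= _.
  by case: eqVneq => //= ->; apply/esym/negbTE.
- by rewrite ffunE eq_sym (negbTE nxy) eqxx.
apply/eqP/ffunP => z; rewrite !ffunE.
by case: (z == x); case: (z == y).
Qed.

Lemma cornerC x y s (t : bool * bool) : x != y -> corner y x s (t.2, t.1) = corner x y s t.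
Proof.
move=> nxy; apply/ffunP => z; rewrite !ffunE; case: eqVneq => [->|//].
by rewrite eq_sym (negbTE nxy).
Qed.

Section Dd.
Variable A : aux G.

Definition path2 x y (u v : ckh_gen A) : int :=
  \sum_(w | edge x (tag u) (tag w) && edge y (tag w) (tag v))
     entry x u w * entry y w v.

(** The ranks and base points are chosen for the face at hand; [gauge] absorbs
    them, since it occurs twice at the intermediate states. *)
Lemma path2C x y u v : path2 x y u v + path2 y x u v = 0.
Proof.
set s := tag u.
case: (boolP [&& x != y, ~~ s x, ~~ s y & tag v == corner x y s top]); last first.
  move=> no; rewrite /path2 !big_pred0 ?addr0 // => w; apply: contraNF no.
    rewrite edge_edge => /and5P[nyx -> -> _ /eqP ->]; rewrite eq_sym nyx /=.
    by rewrite -(cornerC s top nyx).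
  by rewrite edge_edge => /and5P[-> -> -> _ ->].
case/and4P=> nxy sx sy /eqP vE.
have sb : corner x y s bottom = s.
  apply/ffunP => z; rewrite ffunE; case: eqVneq => [->|_]; first exact/esym/negbTE.
  by case: eqVneq => [->|//]; apply/esym/negbTE.
pose X := crossing x y; pose C := corner x y s.
pose st := start x y; pose rep := face_rep x y; pose rank := face_rank x y.
have repP : forall g p, p \in g -> exists2 q, rep g = Some q & q \in g := @face_repP G x y.
have rankI : forall s, {in Gamma s &, injective rank} := @face_rank_inj G x y.
pose kappa := dirsign (st false) (odir A x) * dirsign (st true) (odir A y)
  * (gauge rep rank A s (label u) * gauge rep rank A (tag v) (label v)).
have pathE z : path2 (X z) (X (~~ z)) u v = kappa * \sum_(c <- choices (C (set_at z bottom)) (st z))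
     core rep rank (st z) (C bottom) (C (set_at z bottom)) (label u)
       (update (C (set_at z bottom)) (st z) (label u) c)
     * core rep rank (st (~~ z)) (C (set_at z bottom)) (C top)
       (update (C (set_at z bottom)) (st z) (label u) c) (label v).
  pose c_z := C (set_at z bottom).
  pose F b := core rep rank (st z) (C bottom) c_z (label u) b
              * core rep rank (st (~~ z)) c_z (C top) b (label v).
  have ends (w : ckh_gen A) : edge (X z) s (tag w) && edge (X (~~ z)) (tag w) (tag v)
                = (tag w == c_z).
    rewrite edge_edge vE /c_z /C /X; case: (z) => /=; rewrite -?(cornerC _ _ nxy) /=.
      by rewrite [y == x]eq_sym nxy sx sy eqxx andbT.
    by rewrite nxy sx sy eqxx andbT.
  rewrite /path2 (eq_bigl _ _ ends).
  transitivity (\sum_(w : ckh_gen A | tag w == c_z) kappa * F (label w)).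
    apply: eq_bigr => w tw.
    have /andP[e1 e2] : edge (X z) s (tag w) && edge (X (~~ z)) (tag w) (tag v).
      by rewrite ends.
    rewrite (entryE repP rankI (o := st z)) //.
    rewrite (entryE repP rankI (o := st (~~ z))) //.
    have gg := gauge_sq rep rank A (tag w) (label w).
    rewrite /F -(eqP tw) /C -vE sb -/s /kappa.
    set gu := gauge _ _ _ s _; set gv := gauge _ _ _ (tag v) _.
    set gw := gauge _ _ _ _ _ in gg *; set k1 := core _ _ _ _ _ _ _.
    set k2 := core _ _ _ _ _ _ _.
    rewrite (_ : dirsign (st false) _ * _ = dirsign (st z) (odir A (X z))
        * dirsign (st (~~ z)) (odir A (X (~~ z)))); last by case: (z); rewrite // mulrC.
    move: (dirsign (st z) _) (dirsign (st (~~ z)) _) gw gg => i j gw gg.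
    move: gu gv k1 k2 => gu gv k1 k2.
    transitivity (i * j * (gu * gv) * (gw * gw) * (k1 * k2)); first by ring.
    by rewrite gg mulr1.
  rewrite -mulr_sumr; congr (_ * _).
  have offz : same_off (hx (st z)) (C bottom) c_z by exact: corner_same.
  have offy : same_off (hx (st (~~ z))) c_z (C top).
    have := @corner_same G x y s (~~ z) (set_at z bottom).
    by rewrite (_ : set_at (~~ z) _ = top) //; case: (z).
  apply: (@sum_labels A c_z (st z) (label u) F) => [b b' e|b].
    by rewrite /F; congr (_ * _); apply: core_ext.
  rewrite /F /core; case: (boolP (away_eq (hx (st z)) _ _ b)); last first.
    by rewrite mulr0 mul0r eqxx.
  move=> /forall_inP ab _ g gG away; have := ab g.
  by rewrite (Gamma_away offz away) away => /(_ gG)/eqP ->.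
rewrite -[RHS](mulr0 kappa) -(face_core s nxy (label u) (label v)).
by rewrite big_bool mulrDr -!pathE addrC.
Qed.

(** Both orders in which two crossings are switched occur in the double sum, so
    that it is its own opposite. *)
Lemma CKh_square (v : chain (CKh A)) : diff (diff v) = 0.
Proof.
have square (u w : ckh_gen A) :
    \sum_(z : ckh_gen A) @dif (CKh A) u z * @dif (CKh A) z w = 0.
  pose S := \sum_x \sum_y path2 x y u w.
  have -> : \sum_(z : ckh_gen A) @dif (CKh A) u z * @dif (CKh A) z w = S.
    transitivity (\sum_x \sum_(z : ckh_gen A) \sum_y
        if edge x (tag u) (tag z) && edge y (tag z) (tag w)
        then entry x u z * entry y z w else 0); last first.
      apply: eq_bigr => x _; rewrite exchange_big; apply: eq_bigr => y _.
      by rewrite /path2 [RHS]big_mkcond.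
    rewrite exchange_big /=; apply: eq_bigr => z _.
    rewrite big_distrlr /= big_mkcond; apply: eq_bigr => x _.
    case: ifP => ex /=; last by rewrite big1.
    by rewrite [LHS]big_mkcond.
  suff SS : S + S = 0.
    by move/eqP: SS; rewrite -mulr2n Num.Theory.mulrn_eq0 => /eqP.
  rewrite {1}/S exchange_big /= -big_split /=; apply: big1 => x _.
  by rewrite -big_split /=; apply: big1 => y _; apply: path2C.
apply/ffunP => w; rewrite !ffunE.
under eq_bigr => z _ do rewrite ffunE mulr_suml.
rewrite exchange_big /=; apply: big1 => u _.
under eq_bigr => z _ do rewrite -mulrA.
by rewrite -mulr_sumr square mulr0.
Qed.

End Dd.
End Square.

(** * Maps on homology *)

Section Homology.
Local Open Scope quotient_scope.

Section Null.
Variable C : presentation.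
Implicit Types v w : chain C.

Lemma nullN v : null v -> null (- v).
Proof. by rewrite -sub0r; apply: nullB; apply: null0. Qed.

Lemma nullD v w : null v -> null w -> null (v + w).
Proof. by move=> nv nw; rewrite -[w]opprK; apply: nullB => //; apply: nullN. Qed.

Lemma null_trans w v u : null (v - w) -> null (w - u) -> null (v - u).
Proof. by move=> vw wu; rewrite -(subrKA w); apply: nullD. Qed.

Lemma cocycleP i (z : cocycle C i) :
  homog (fun j => j == i) (val z) /\ null (diff (val z)).
Proof. by have /asboolP := valP z. Qed.

End Null.

Section Transport.
Variables (C D : presentation) (f : {additive chain C -> chain D}).

Definition chain_map : Prop :=
  [/\ forall P v, homog P v -> homog P (f v), forall v, null v -> null (f v)
    & forall v, null (f (diff v) - diff (f v))].

Hypothesis fP : chain_map.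
Variable i : nat.

Lemma map_cocycle (z : cocycle C i) : f (val z) \in @cocycles D i.
Proof.
case: fP => fh fn fd; have [hz nz] := cocycleP z; apply/asboolP; split; first exact: fh.
by rewrite -[diff _](subKr (f (diff (val z)))); apply: nullB; [exact: fn | exact: fd].
Qed.

Definition on_cocycles (z : cocycle C i) : cocycle D i := Cocycle (map_cocycle z).

Lemma on_cocyclesB : {morph on_cocycles : y z / y - z}.
Proof. by move=> y z; apply: val_inj; rewrite raddfB /= raddfB. Qed.

Lemma on_cocycles_bound z :
  z \in @coboundaries C i -> on_cocycles z \in @coboundaries D i.
Proof.
case: fP => fh fn fd /asboolP[w hw nw]; apply/asboolP; exists (f w); first exact: fh.
apply: (null_trans (w := f (diff w))); last exact: fd.
by rewrite -[val (on_cocycles z)]/(f (val z)) -raddfB; apply: fn.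
Qed.

Local Notation HC := {ideal_quot (@coboundaries C i)}.
Local Notation HD := {ideal_quot (@coboundaries D i)}.

Definition on_homology (q : HC) : HD := \pi_HD (on_cocycles (generic_quotient.repr q)).

Lemma on_homology_pi z : on_homology (\pi_HC z) = \pi_HD (on_cocycles z).
Proof.
apply/eqP; rewrite /on_homology -Quotient.idealrBE -on_cocyclesB.
apply: on_cocycles_bound; rewrite Quotient.idealrBE; apply/eqP.
exact: reprK.
Qed.

Lemma on_homologyB : {morph on_homology : p q / p - q}.
Proof.
move=> p q; rewrite -[p]reprK -[q]reprK -raddfB !on_homology_pi on_cocyclesB.
by rewrite raddfB.
Qed.

HB.instance Definition _ :=
  GRing.isZmodMorphism.Build HC HD on_homology on_homologyB.

End Transport.

Lemma on_homologyK (C D : presentation)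
    (f : {additive chain C -> chain D}) (h : {additive chain D -> chain C})
    (fP : chain_map f) (hP : chain_map h) i :
  (forall v, null (h (f v) - v)) ->
  cancel (on_homology fP (i := i)) (on_homology hP (i := i)).
Proof.
move=> hf q; rewrite -[q]reprK; move: (generic_quotient.repr q) => z.
rewrite (on_homology_pi fP z) (on_homology_pi hP); apply/eqP.
rewrite -Quotient.idealrBE; apply/asboolP; exists 0; first exact: homog0.
by rewrite diff0 subr0 raddfB; exact: (hf (val z)).
Qed.

Lemma homology_iso (C D : presentation)
    (f : {additive chain C -> chain D}) (h : {additive chain D -> chain C}) i :
  chain_map f -> chain_map h ->
  (forall v, null (h (f v) - v)) -> (forall w, null (f (h w) - w)) ->
  isog (homology C i) (homology D i).
Proof.
move=> fP hP hf fh; exists (on_homology fP (i := i) : {additive _ -> _}).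
by exists (on_homology hP (i := i)); apply: on_homologyK.
Qed.

Lemma isog_sym (U V : zmodType) : isog U V -> isog V U.
Proof.
case=> f [g fK gK].
have gB : zmod_morphism g.
  by move=> x y; apply: (can_inj fK); rewrite raddfB !gK.
pose gA := GRing.isZmodMorphism.Build V U g gB.
pose g' : {additive V -> U} := HB.pack g gA.
by exists g'; exists f.
Qed.

Lemma isog_trans (U V W : zmodType) : isog U V -> isog V W -> isog U W.
Proof.
case=> f bf [g bg]; exists (g \o f : {additive U -> W}); exact: bij_comp.
Qed.

End Homology.

(** * Orientations of components *)

Section Orientations.
Variable G : gauss.
Implicit Types (s t : state G) (h k o : half G) (p q : pt G) (g w : {set pt G}).
Implicit Types (x y : gX G).

Definition base_point g : option (pt G) := [pick p in g].

Definition index_rank g : nat := enum_rank g.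

Lemma base_pointP g p : p \in g -> exists2 q, base_point g = Some q & q \in g.
Proof.
rewrite /base_point; case: pickP => [q qg _|no pg]; first by exists q.
by have := no p; rewrite pg.
Qed.

Lemma index_rank_inj s : {in Gamma s &, injective index_rank}.
Proof. by move=> g g' _ _ /val_inj/enum_rank_inj. Qed.

Local Notation bside := (side base_point).

Definition into_base g w : bool := if base_point g is Some p then p \in w else false.

(** The orientation of [g] that leads into the crossing at the base point. *)
Definition wside s g : {set pt G} := [set p in g | ~~ bside s p].

Lemma wsideP s g : g \in Gamma s -> orientation s g (wside s g).
Proof.
move=> gG; apply/andP; split; first by apply/subsetP => p; rewrite inE => /andP[].
apply/forallP => h; apply/implyP => hg; have gE := GammaP gG hg.
have fg : inl (far h) \in g by rewrite gE -comp_eqP comp_far.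
have jg : inl (join s h) \in g by rewrite gE -comp_eqP comp_join.
by rewrite !inE fg jg hg (side_far base_pointP) (side_join base_pointP) negbK eqxx.
Qed.

Lemma side_base s g p : g \in Gamma s -> base_point g = Some p -> bside s p = false.
Proof.
move=> gG bg; have pg : p \in g.
  have [q qg] := Gamma_neq0 gG; have [q' e q'g] := base_pointP qg.
  by move: q'g; rewrite bg in e; case: e => ->.
case: p bg pg => [h|f] bg hg; last by rewrite /side; case: (base_point _) => // -[].
by rewrite /side -(GammaP gG hg) bg along_refl.
Qed.

Lemma orientation_along s g w h k :
  g \in Gamma s -> orientation s g w -> inl h \in g -> along s h k ->
  (inl k \in w) = (inl h \in w).
Proof.
move=> gG /andP[_ /forallP ow] hg; case/alongP=> n <-.
have inG m : inl (iter m (turn s) h) \in g.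
  by rewrite (GammaP gG hg) in_comp_half /linked along_iter.
elim: n => //= n <-; set l := iter n _ h.
have lg : inl l \in g by exact: inG.
have fg : inl (far l) \in g by rewrite (GammaP gG lg) -comp_eqP comp_far.
have /implyP/(_ fg)/andP[_ /eqP e2] := ow (far l).
by have /implyP/(_ lg)/andP[/eqP e1 _] := ow l; rewrite e2 e1 negbK.
Qed.

(** An orientation alternates along the component, like [side]; it is determined
    by its value at the base point. *)
Lemma mem_orientation s g w p :
  g \in Gamma s -> orientation s g w -> p \in g ->
  (p \in w) = into_base g w (+) bside s p.
Proof.
move=> gG ow pg; rewrite /into_base; case: p pg => [h|f] hg; last first.
  have gE := GammaP gG hg; have [q -> ] := base_pointP hg.
  rewrite gE comp_free inE => /eqP ->.
  by rewrite /side; case: (base_point _) => [[]|]; rewrite addbF.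
have gE := GammaP gG hg; have := rep_half base_pointP s h; rewrite -gE => -[r br rh].
rewrite br; have rg : inl r \in g by rewrite gE in_comp_half linked_sym.
rewrite /side -gE br; case/orP: (rh) => [al|fal].
  by rewrite al addbF (orientation_along gG ow rg al).
have fg : inl (far r) \in g by rewrite (GammaP gG rg) -comp_eqP comp_far.
rewrite (orientation_along gG ow fg fal) -[along s r h]negbK -(along_or rh) fal addbT.
by have /andP[_ /forallP/(_ r)/implyP/(_ rg)/andP[/eqP]] := ow.
Qed.

Lemma into_base_wside s g : g \in Gamma s -> into_base g (wside s g).
Proof.
move=> gG; have [p /base_pointP[q bq qg]] := Gamma_neq0 gG.
by rewrite /into_base bq inE qg (side_base gG bq).
Qed.

Lemma into_base_reverse s g w : g \in Gamma s -> into_base g (g :\: w) = ~~ into_base g w.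
Proof.
move=> gG; have [p /base_pointP[q bq qg]] := Gamma_neq0 gG.
by rewrite /into_base bq inE qg andbT.
Qed.

Lemma orientation_eq s g w : g \in Gamma s -> orientation s g w ->
  w = if into_base g w then wside s g else g :\: wside s g.
Proof.
move=> gG ow; have /andP[/subsetP sw _] := ow; apply/setP => p.
case pg: (p \in g); last first.
  have -> : (p \in w) = false by apply/negP => /sw; rewrite pg.
  by case: ifP; rewrite !inE pg.
rewrite (mem_orientation gG ow pg).
by case: (into_base g w); rewrite !inE pg /= ?andbT ?negbK.
Qed.

Lemma orientation_reverse s g w : g \in Gamma s ->
  orientation s g w -> orientation s g (g :\: w).
Proof.
move=> gG /andP[_ /forallP ow]; apply/andP; split; first exact: subsetDl.
apply/forallP => h; apply/implyP => hg; have gE := GammaP gG hg.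
have fg : inl (far h) \in g by rewrite gE -comp_eqP comp_far.
have jg : inl (join s h) \in g by rewrite gE -comp_eqP comp_join.
have /implyP/(_ hg)/andP[/eqP e1 /eqP e2] := ow h.
by rewrite !inE fg jg hg !andbT e1 e2 eqxx.
Qed.

Variable r : gcirc G -> bool.

Lemma ss_into_opp h : ss_into r (opp h) = ss_into r h.
Proof.
case: h => [[x b] e]; rewrite /ss_into /left /outward /cw /ccw /opp /hx /over /onext /=.
by case: b; case: e; case: (gpos x); case: (r _); case: (r _).
Qed.

Lemma ss_into_join s h : ss_into r (join s h) = ~~ ss_into r h.
Proof.
rewrite joinE; case: h => [[x b] e].
rewrite /ss_into /left /outward /cw /ccw /opp /hx /over /onext /=.
by case: b; case: e; case: (gpos x); case: (s x) => /=; case: (r _); case: (r _).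
Qed.

Lemma hx_topleft x : hx (topleft r x) = x.
Proof. by rewrite /topleft; case: ifP. Qed.

Lemma ss_into_topleft x : ss_into r (topleft r x).
Proof.
rewrite /topleft /ss_into /left /outward /cw /ccw /opp /hx /over /onext /=.
by case e0: (gpos x); case e1: (r (gon (x, true))); case e2: (r (gon (x, false)));
  rewrite /= ?e1 ?e2 /= ?e1 ?e2 /= ?e0.
Qed.

(** Both [ss_into] and an orientation are exchanged by [join] and preserved by
    [opp] on a component whose two strands run in the same direction. *)
Lemma local_orientationE s g w o :
  ss_into r o -> (linked s o (opp o) -> along s o (opp o)) ->
  g = comp s (inl o) -> orientation s g w ->
  local_orientation r (hx o) g w = (inl o \in w).
Proof.
move=> so al gE ow; have gG : g \in Gamma s by rewrite gE Gamma_comp.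
have og : inl o \in g by rewrite gE comp_refl.
apply/forallP/idP => [/(_ o)|ow' h]; first by rewrite eqxx og so => /eqP.
apply/implyP => /andP[/eqP hh hg].
have oppw : inl (opp o) \in g -> inl (opp o) \in w.
  by move=> ong; rewrite (orientation_along gG ow og) // al // -in_comp_half -gE.
have joinw k : inl k \in g -> inl k \in w -> (inl (join s k) \in w) = false.
  move=> kg kw; have /andP[_ /forallP/(_ k)/implyP/(_ kg)/andP[_ /eqP ->]] := ow.
  by rewrite kw.
move: hg; case/or4P: (hx_eq s hh) => /eqP -> hg.
- by rewrite so ow'.
- by rewrite ss_into_opp so oppw.
- by rewrite ss_into_join so joinw.
rewrite ss_into_opp ss_into_join so -join_opp joinw // ?oppw //.
  by move: hg; rewrite -join_opp gE -!comp_eqP comp_join.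
by move: hg; rewrite -join_opp gE -!comp_eqP comp_join.
Qed.

End Orientations.

(** * Expressions up to sign *)

Section Wedges.
Variable G : gauss.
Implicit Types (s t : state G) (h k o : half G) (p q : pt G) (g w : {set pt G}).
Implicit Types (x y : gX G) (f : factor G) (l : seq (factor G)).

Definition wf_seq s l : bool :=
  perm_eq (components l) (enum (Gamma s)) && all (wf_factor s) l.

Lemma wedge_wf (v : wedge G) : wf_seq (wstate v) (factors v).
Proof. exact: valP v. Qed.

Lemma mk_wedge s l : wf_seq s l -> {v : wedge G | wstate v = s & factors v = l}.
Proof.
move=> wfl; have sz : size l == #|Gamma s|.
  by case/andP: wfl => /perm_size; rewrite size_map -cardE => ->.
pose u : {s : state G & #|Gamma s|.-tuple (factor G)} := existT _ s (Tuple sz).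
have wfu : wf u by [].
by exists (Sub u wfu).
Qed.

Lemma wedge_eq (u v : wedge G) :
  wstate u = wstate v -> factors u = factors v -> u = v.
Proof.
case: u v => [[s l] wl] [[t l'] wl'] /= e; rewrite /wstate /factors /= in e *.
subst t => e; apply: val_inj => /=; congr existT; exact: val_inj.
Qed.

Section Wf.
Variables (s : state G) (l : seq (factor G)).
Hypothesis wfl : wf_seq s l.

Lemma components_uniq : uniq (components l).
Proof. by case/andP: wfl => /perm_uniq ->; rewrite enum_uniq. Qed.

Lemma mem_components g : (g \in components l) = (g \in Gamma s).
Proof. by case/andP: wfl => /perm_mem ->; rewrite mem_enum. Qed.

Lemma factor_Gamma f : f \in l -> f.1 \in Gamma s.
Proof. by move=> fl; rewrite -mem_components map_f. Qed.

Lemma factor_wf f : f \in l -> wf_factor s f.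
Proof. by case/andP: wfl => _ /allP; apply. Qed.

Lemma factor_inj f f' : f \in l -> f' \in l -> f.1 = f'.1 -> f = f'.
Proof.
move=> fl fl'; have := components_uniq; rewrite /components => u.
have /(nthP f)[i lt <-] := fl; have /(nthP f)[j lt' <-] := fl'.
rewrite -!(nth_map f f.1) // => /eqP.
by rewrite nth_uniq ?size_map // => /eqP ->.
Qed.

Lemma xlabelE f : f \in l -> xlabel l f.1 = (f.2 != None).
Proof.
move=> fl; apply/hasP/idP => [[f' fl' /andP[/eqP e]]|nf]; last by exists f; rewrite ?eqxx.
by rewrite (factor_inj fl' fl e).
Qed.

Lemma prod_components (F : {set pt G} -> int) x :
  \prod_(f <- l | passes x f.1) F f.1 = \prod_(g in Gamma s | passes x g) F g.
Proof.
rewrite -(big_map fst (passes x)) /=; case/andP: wfl => /(perm_big _) -> _ /=.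
by rewrite big_enum_cond.
Qed.

End Wf.

(** Compares the orientation with the one that leads into the base point. *)
Definition fsign f : int :=
  if f.2 is Some w then (-1) ^+ ~~ into_base f.1 w else 1.

Lemma fsign_sq f : fsign f * fsign f = 1.
Proof. by rewrite /fsign; case: f.2 => [w|]; rewrite ?mulr1 // -expr2 sqrr_sign. Qed.

(** [wedge_relator] identifies the expression with this sign times the one in which
    the components increase and all orientations lead into the base points. *)
Definition osign l : int :=
  rho (map (@index_rank G) (components l)) * \prod_(f <- l) fsign f.

Lemma osign_sq l : osign l * osign l = 1.
Proof.
rewrite /osign mulrACA rho_sq mul1r -big_split /=.
by apply: big1 => f _; exact: fsign_sq.
Qed.

(** A permutation of the factors changes [osign] by the sign in [wedge_relator]. *)
Lemma osign_perm s l l' : wf_seq s l -> perm_eq l l' ->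
  osign l' = eps (components l) (components l') * osign l.
Proof.
move=> wfl pe; have pc : perm_eq (components l) (components l') by exact: perm_map.
rewrite (@eps_rho _ (@index_rank G)) //; last first.
  apply: (map_rank_uniq (@index_rank_inj G) (s := s)); first exact: components_uniq wfl.
  by move=> g; rewrite (mem_components wfl).
rewrite /osign (perm_big _ pe) /=.
have := rho_sq (map (@index_rank G) (components l)).
set i := rho _; set j := rho _; set q := \prod_(_ <- _) _ => ii.
by transitivity (i * i * (j * q)); [rewrite ii mul1r | ring].
Qed.

Lemma osign_reverse s l1 l2 g w : wf_seq s (l1 ++ (g, Some w) :: l2) ->
  osign (l1 ++ (g, Some (g :\: w)) :: l2) = - osign (l1 ++ (g, Some w) :: l2).
Proof.
move=> wfl; have gG : g \in Gamma s.
  by rewrite -(mem_components wfl) /components map_cat mem_cat inE eqxx orbT.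
rewrite /osign /components !map_cat /= !big_cat !big_cons /= -mulrN; congr (_ * _).
rewrite -mulrN -mulNr; congr (_ * (_ * _)).
by rewrite /fsign /= (into_base_reverse _ gG); case: into_base; rewrite /= ?opprK.
Qed.

Lemma xlabel_perm l l' : perm_eq l l' -> xlabel l =1 xlabel l'.
Proof. by move=> pe g; rewrite /xlabel; apply/perm_has. Qed.

Lemma xlabel_reverse l1 l2 g w w' :
  xlabel (l1 ++ (g, Some w) :: l2) =1 xlabel (l1 ++ (g, Some w') :: l2).
Proof. by move=> g'; rewrite /xlabel !has_cat /=. Qed.

Section Normal.
Variable r : gcirc G -> bool.
Local Notation nullK := (@null (Kh r)).
Local Notation signed v := (delta v *~ osign (factors v)).

Lemma nullMz (C : presentation) (c : chain C) n : null c -> null (c *~ n).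
Proof.
move=> nc; have nat_case m : null (c *+ m).
  by elim: m => [|m IHm]; rewrite ?mulr0n ?mulrS; [exact: null0 | exact: nullD].
by case: n => m; [exact: nat_case | exact/nullN/nat_case].
Qed.

(** Hence the multiples [signed v] of reordered and reoriented expressions agree
    up to relators. *)
Lemma null_perm (u v : wedge G) : wstate u = wstate v ->
  perm_eq (factors u) (factors v) -> nullK (signed u - signed v).
Proof.
move=> es pe; have ep := osign_perm (wedge_wf v) (etrans (perm_sym _ _) pe).
set e := eps _ _ in ep.
have ee : e * e = 1.
  have := osign_sq (factors u).
  by rewrite ep mulrACA osign_sq mulr1.
have -> : signed u - signed v = (delta u - delta v *~ e) *~ osign (factors u).
  rewrite mulrzBl -mulrzA; congr (_ - _ *~ _).
  by rewrite ep mulrA ee mul1r.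
by apply/nullMz/null_relator/wedge_perm; rewrite ?(perm_sym (factors v)).
Qed.

Lemma null_reverse (u v : wedge G) l1 l2 g w : wstate u = wstate v ->
  factors u = l1 ++ (g, Some w) :: l2 ->
  factors v = l1 ++ (g, Some (g :\: w)) :: l2 -> nullK (signed u - signed v).
Proof.
move=> es eu ev; have wfu := wedge_wf u; rewrite eu in wfu.
rewrite ev (osign_reverse wfu) -eu mulrNz opprK -mulrzDl.
exact/nullMz/null_relator/(wedge_reverse es eu ev).
Qed.

Definition oriented s f : factor G :=
  if f.2 is Some w then (f.1, Some (wside s f.1)) else f.

Lemma wf_oriented s l1 l2 :
  wf_seq s (l1 ++ l2) -> wf_seq s (map (oriented s) l1 ++ l2).
Proof.
move=> wfl; have /andP[pl al] := wfl; apply/andP; split.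
  rewrite (perm_trans _ pl) // /components !map_cat -map_comp perm_cat2r.
  suff -> : map (fst \o oriented s) l1 = map fst l1 by [].
  by apply: eq_map => -[g [w|]].
move: al; rewrite !all_cat => /andP[al1 ->]; rewrite andbT.
apply/allP => f /mapP[f' f'l ->]; have := allP al1 f' f'l.
have gG : f'.1 \in Gamma s by apply: (factor_Gamma wfl); rewrite mem_cat f'l.
by case: f' gG {f'l} => g [w|] //= gG _; apply: wsideP.
Qed.

(** The factors are reoriented one after the other, from left to right. *)
Lemma null_oriented (u v : wedge G) : wstate v = wstate u ->
  factors v = map (oriented (wstate u)) (factors u) -> nullK (signed u - signed v).
Proof.
set s := wstate u => es ev.
suff main l1 l2 (u' : wedge G) : wf_seq s (l1 ++ l2) ->
    wstate u' = s -> factors u' = map (oriented s) l1 ++ l2 ->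
    forall v' : wedge G, wstate v' = s -> factors v' = map (oriented s) (l1 ++ l2) ->
    nullK (signed u' - signed v').
  exact: (main [::] (factors u) u (wedge_wf u)).
elim: l2 l1 u' => [|f l2 IHl] l1 u' wfl eu fu v' ev' fv'.
  have -> : u' = v' by apply: wedge_eq; rewrite ?ev' // fu fv' !cats0.
  by rewrite subrr; exact: null0.
rewrite -cat_rcons in wfl fv'.
have [u2 eu2 fu2] := mk_wedge (wf_oriented wfl).
apply: null_trans (IHl _ u2 wfl eu2 fu2 v' ev' fv').
move: fu2; rewrite map_rcons cat_rcons => fu2.
have fin : f \in rcons l1 f ++ l2 by rewrite mem_cat mem_rcons mem_head.
have gG := factor_Gamma wfl fin; have wff := factor_wf wfl fin.
case: f {fin fv' wfl} => g [w|] /= in gG wff fu fu2 *; last first.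
  have -> : u' = u2 by apply: wedge_eq; rewrite ?eu ?fu ?fu2.
  by rewrite subrr; exact: null0.
move: (orientation_eq gG wff); case: ifP => _ wE.
  have -> : u' = u2 by apply: wedge_eq; rewrite ?eu ?fu ?fu2 // wE.
  by rewrite subrr; exact: null0.
apply: (null_reverse _ fu); rewrite ?eu ?eu2 // fu2 /oriented /= wE setDDr setDv set0U.
by congr (_ ++ (_, Some _) :: _); apply/esym/setIidPr/subsetP => p; rewrite inE => /andP[].
Qed.

End Normal.

End Wedges.

(** * The map from expressions to labelled states *)

Section Comparison.
Variables (G : gauss) (A : aux G) (r : gcirc G -> bool).
Implicit Types (s t : state G) (h k o : half G) (p q : pt G) (g w : {set pt G}).
Implicit Types (x y : gX G) (f : factor G) (l : seq (factor G)).
Implicit Types (u : ckh_gen A) (v : wedge G).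
Local Notation signed v := (delta v *~ osign (factors v)).
Local Notation gauge := (gauge (@base_point G) (@index_rank G) A).

(** The sign that replaces the directions of [A] by the top left half-edges. *)
Definition zeta s : int := \prod_(x | s x) dirsign (topleft r x) (odir A x).

Definition under v : ckh_gen A := with_labels A (wstate v) (xlabel (factors v)).

Definition wsign v : int :=
  zeta (wstate v) * osign (factors v) * gauge (wstate v) (xlabel (factors v)).

Lemma label_under v : {in Gamma (wstate v), label (under v) =1 xlabel (factors v)}.
Proof. by move=> g; apply: label_with. Qed.

Lemma zeta_sq s : zeta s * zeta s = 1.
Proof. by rewrite -big_split /=; apply: big1 => x _; apply: dirsign_sq. Qed.

Lemma wsign_sq v : wsign v * wsign v = 1.
Proof. by rewrite /wsign mulrACA gauge_sq mulr1 mulrACA zeta_sq osign_sq mulr1. Qed.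

Definition canon_factor u g : factor G :=
  (g, if label u g then Some (wside (tag u) g) else None).

Lemma wf_canon u : wf_seq (tag u) (map (canon_factor u) (ord A (tag u))).
Proof.
have [us sG] := ordP A (tag u); apply/andP; split.
  rewrite /components -map_comp map_id_in //.
  by apply: uniq_perm; rewrite ?enum_uniq // => g; rewrite mem_enum sG.
apply/allP => f /mapP[g]; rewrite sG => gG ->.
by rewrite /wf_factor /=; case: (label u g) => //=; apply: wsideP.
Qed.

(** A preimage of [u] under [forget], up to sign. *)
Definition canon u : wedge G := s2val (mk_wedge (wf_canon u)).

Lemma wstate_canon u : wstate (canon u) = tag u.
Proof. exact: (s2valP (mk_wedge (wf_canon u))). Qed.

Lemma factors_canon u : factors (canon u) = map (canon_factor u) (ord A (tag u)).
Proof. exact: (s2valP' (mk_wedge (wf_canon u))). Qed.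

Lemma canonK : cancel canon under.
Proof.
move=> u; rewrite /under wstate_canon; apply/eqP/with_labelsP; split=> // g gG.
have [us sG] := ordP A (tag u).
have wfc := wedge_wf (canon u); rewrite wstate_canon factors_canon in wfc.
rewrite factors_canon -[g in RHS]/(canon_factor u g).1 (xlabelE wfc).
  by rewrite /=; case: (label u g).
by rewrite map_f ?sG.
Qed.

(** Reorientation and reordering lead to the chosen expression with these labels. *)
Lemma null_canon v : null (C := Kh r) (signed v - signed (canon (under v))).
Proof.
have wfv := wedge_wf v.
have [v' es' ev'] := mk_wedge (wf_oriented (l1 := factors v) (l2 := [::])
  (etrans (congr1 _ (cats0 _)) wfv)).
rewrite cats0 in ev'.
apply: (@null_trans (Kh r) (signed v')); first exact: null_oriented.
apply: null_perm; first by rewrite wstate_canon es'.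
rewrite ev' factors_canon.
have -> : map (oriented (wstate v)) (factors v)
          = map (canon_factor (under v)) (components (factors v)).
  rewrite -map_comp; apply/eq_in_map => f fl /=.
  rewrite /canon_factor /= label_under ?(factor_Gamma wfv fl) // (xlabelE wfv) //.
  by case: f {fl} => g [w|].
apply: perm_map; have [us sG] := ordP A (wstate v).
apply: uniq_perm => //; first exact: components_uniq wfv.
by move=> g; rewrite (mem_components wfv) sG.
Qed.

Definition forget (c : chain (Kh r)) : chain (CKh A) :=
  [ffun u => \sum_v c v * (wsign v * (under v == u)%:R)].

Definition express (d : chain (CKh A)) : chain (Kh r) :=
  [ffun v => \sum_u d u * (wsign (canon u) * (canon u == v)%:R)].

Lemma forgetB : zmod_morphism forget.
Proof.
move=> c d; apply/ffunP => u; rewrite !ffunE -sumrB; apply: eq_bigr => v _.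
by rewrite !ffunE mulrBl.
Qed.

Lemma expressB : zmod_morphism express.
Proof.
move=> c d; apply/ffunP => u; rewrite !ffunE -sumrB; apply: eq_bigr => v _.
by rewrite !ffunE mulrBl.
Qed.

HB.instance Definition _ := GRing.isZmodMorphism.Build _ _ forget forgetB.
HB.instance Definition _ := GRing.isZmodMorphism.Build _ _ express expressB.

Lemma expressK : cancel express forget.
Proof.
move=> d; apply/ffunP => u; rewrite ffunE.
under eq_bigr => v _ do rewrite ffunE mulr_suml.
rewrite exchange_big (bigD1 u) //= [X in _ + X]big1 => [|u' nu].
  rewrite (bigD1 (canon u)) //= big1 => [|v nv].
    by rewrite canonK !eqxx !mulr1 -mulrA wsign_sq mulr1 !addr0.
  by rewrite eq_sym (negbTE nv) !(mulr0, mul0r).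
apply: big1 => v _; case: (eqVneq (canon u') v) => [<-|_]; last first.
  by rewrite !(mulr0, mul0r).
by rewrite canonK (negbTE nu) !mulr0.
Qed.

Lemma forget_delta v : forget (delta v) = [ffun u => wsign v * (under v == u)%:R].
Proof.
apply/ffunP => u; rewrite !ffunE (bigD1 v) //= big1 => [|v' nv].
  by rewrite ffunE eqxx mul1r addr0.
by rewrite ffunE eq_sym (negbTE nv) mul0r.
Qed.

Lemma chain_delta (c : chain (Kh r)) : c = \sum_v delta v *~ c v.
Proof.
apply/ffunP => v; rewrite sum_ffunE (bigD1 v) //= big1 => [|v' nv].
  by rewrite ffunMzE ffunE eqxx addr0 intz.
by rewrite ffunMzE ffunE (negbTE nv) mul0rz.
Qed.
Lemma under_ext v v' : wstate v = wstate v' ->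
  xlabel (factors v) =1 xlabel (factors v') -> under v = under v'.
Proof.
move=> es ex; apply/eqP/with_labelsP; split; first by rewrite /= es.
by move=> g gG; rewrite label_under -?es // ex.
Qed.

(** [osign] changes under a relator by the sign that the relator prescribes. *)
Lemma forget_null c : null (C := Kh r) c -> forget c = 0.
Proof.
elim=> {c} [c||c d _ c0 _ d0]; [|exact: raddf0|by rewrite raddfB /= c0 d0 subrr].
have same v v' e : wstate v = wstate v' -> xlabel (factors v) =1 xlabel (factors v') ->
    osign (factors v') = e * osign (factors v) -> forget (delta v' - delta v *~ e) = 0.
  move=> es ex eo; rewrite raddfB raddfMz /= !forget_delta.
  apply/ffunP => u; rewrite !ffunE ffunMzE ffunE -(under_ext es ex).
  rewrite /wsign -es eo -(@gauge_ext _ _ _ A _ _ _ (fun g _ => ex g)) -mulrzl intz.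
  by apply/eqP; rewrite subr_eq0; apply/eqP; ring.
case=> [v v' es pe | v v' l1 l2 g w es ev ev'].
  exact: same es (xlabel_perm pe) (osign_perm (wedge_wf v) pe).
have wfv := wedge_wf v; rewrite ev in wfv.
rewrite addrC -[delta v]opprK -[- delta v]mulrN1z; apply: same => //.
  by rewrite ev ev'; apply: xlabel_reverse.
by rewrite ev ev' (osign_reverse wfv) mulN1r.
Qed.

Lemma null_sum (C : presentation) (I : finType) (F : I -> chain C) :
  (forall i, null (F i)) -> null (\sum_i F i).
Proof.
move=> nF; elim/big_ind: _ => [|c d nc nd|i _]; [exact: null0|exact: nullD|exact: nF].
Qed.

Lemma express_delta u :
  express [ffun u' => (u == u')%:R] = delta (canon u) *~ wsign (canon u).
Proof.
apply/ffunP => v; rewrite !ffunE (bigD1 u) //= big1 => [|u' nu].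
  by rewrite ffunE eqxx mul1r addr0 ffunMzE ffunE -mulrzr intz mulrC.
by rewrite ffunE eq_sym (negbTE nu) mul0r.
Qed.

(** By [null_canon], applied to each expression. *)
Lemma forgetK c : null (C := Kh r) (express (forget c) - c).
Proof.
have -> : express (forget c) - c
    = \sum_v (express (forget (delta v *~ c v)) - delta v *~ c v).
  by rewrite sumrB [X in _ - X](chain_delta c) {1}(chain_delta c) !raddf_sum.
apply: null_sum => v; rewrite raddfMz /= raddfMz /= -mulrzBl.
apply: nullMz; set u := under v.
have -> : forget (delta v) = [ffun u' => (u == u')%:R] *~ wsign v.
  by rewrite forget_delta; apply/ffunP => u'; rewrite ffunMzE !ffunE -mulrzr intz mulrC.
rewrite raddfMz /= express_delta -mulrzA.
have gE : gauge (wstate v) (xlabel (factors v))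
          = gauge (tag u) (xlabel (factors (canon u))).
  apply: gauge_ext => g gG; rewrite -label_under // -/u.
  by rewrite -[in LHS](canonK u) label_under ?wstate_canon.
have -> : wsign (canon u) * wsign v = osign (factors (canon u)) * osign (factors v).
  rewrite /wsign wstate_canon gE mulrACA gauge_sq mulr1 mulrACA.
  by rewrite -[zeta (wstate v)]/(zeta (tag u)) zeta_sq mul1r.
have -> : delta (canon u) *~ (osign (factors (canon u)) * osign (factors v)) - delta v
    = - ((signed v - signed (canon u)) *~ osign (factors v)).
  by rewrite mulrzBl opprB -!mulrzA osign_sq mulr1z.
apply/nullN/nullMz; exact: null_canon.
Qed.

Lemma homog_forget P c : homog P c -> homog P (forget c).
Proof.
move=> hc u nu; rewrite ffunE big1 // => v _; case: eqP => [e|_]; last by rewrite !mulr0.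
by rewrite hc ?mul0r //; move: nu; rewrite /= -e.
Qed.

Lemma homog_express P d : homog P d -> homog P (express d).
Proof.
move=> hd v nv; rewrite ffunE big1 // => u _; case: eqP => [e|_]; last by rewrite !mulr0.
by rewrite hd ?mul0r //; move: nv; rewrite /= -e wstate_canon.
Qed.


End Comparison.

(** * Comparison of the edge maps *)

Section EdgeMaps.
Variables (G : gauss) (r : gcirc G -> bool).
Implicit Types (s t : state G) (h k o : half G) (p q : pt G) (g w : {set pt G}).
Implicit Types (x y : gX G) (f : factor G) (l : seq (factor G)).
Implicit Types (a b : {set pt G} -> bool).
Local Notation bside := (side (@base_point G)).
Local Notation tl := (topleft r).

(** The orientation of [g] that enters the crossing along the end of [g] there. *)
Definition local_factor t o b g : factor G :=
  (g, if b g then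
        Some (if bside t (inl (passing_end t o g)) then g :\: wside t g else wside t g)
      else None).

Lemma strandsE s x : strands r s x = pass s (tl x). Proof. by []. Qed.

(** The local orientation exists on the components at the crossing; by
    [localV_along] this holds wherever the local map is not zero. *)
Definition coherent s o : Prop := linked s o (opp o) -> along s o (opp o).

Lemma local_end s x g w : coherent s (tl x) -> g \in pass s (tl x) ->
  orientation s g w ->
  local_orientation r x g w = into_base g w (+) bside s (inl (passing_end s (tl x) g)).
Proof.
move=> gd gp ow; have gG := pass_Gamma gp.
set o := passing_end _ _ _; have gE : g = comp s (inl o) by exact: passing_endP.
have so : ss_into r o.
  by rewrite /o /passing_end; case: ifP; rewrite ?ss_into_opp ss_into_topleft.
have xo : hx o = x by rewrite /o /passing_end; case: ifP; rewrite ?hx_opp hx_topleft.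
have go : coherent s o.
  by rewrite /o /passing_end /coherent; case: ifP => // _; rewrite oppK linked_sym along_sym.
rewrite -[in LHS]xo (local_orientationE so go gE ow) (mem_orientation gG ow) //.
by rewrite gE comp_refl.
Qed.

(** [local_sign] compares with the local orientation, [fsign] with the base point;
    the product compares the local orientation with the base point. *)
Lemma local_sign_twist s x l : wf_seq s l -> coherent s (tl x) ->
  local_sign r x l * \prod_(f <- l | passes x f.1) fsign f
  = twist (@base_point G) s (tl x) (xlabel l).
Proof.
move=> wfl gd; rewrite /local_sign -big_split /=.
pose F g := (-1) ^+ (xlabel l g && bside s (inl (passing_end s (tl x) g))) : int.
transitivity (\prod_(f <- l | passes x f.1) F f.1).
  rewrite big_seq_cond [RHS]big_seq_cond; apply: eq_bigr => f /andP[fl px].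
  have gG := factor_Gamma wfl fl; have wff := factor_wf wfl fl.
  have gp : f.1 \in pass s (tl x) by rewrite mem_pass ?hx_topleft.
  rewrite /F (xlabelE wfl fl) /fsign; case: f gp wff {fl px gG} => g [w|] //= gp ow.
  by rewrite (local_end gd gp ow); case: into_base; case: bside.
rewrite (prod_components wfl) /twist.
rewrite [RHS]big_uniq ?undup_uniq //; apply: eq_bigl => g.
apply/andP/idP => [[gG]|gp]; first by rewrite mem_pass // hx_topleft.
by have gG := pass_Gamma gp; have := mem_pass (tl x) gG; rewrite gp hx_topleft gG => <-.
Qed.

Lemma fsign_local t x b : coherent t (tl x) ->
  \prod_(f <- map (local_factor t (tl x) b) (pass t (tl x))) fsign f
  = twist (@base_point G) t (tl x) b.
Proof.
move=> gd; rewrite big_map /twist; apply: eq_big_seq => g gp.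
have gG := pass_Gamma gp; rewrite /fsign /local_factor /=; case: (b g) => //=.
by case: (bside _ _); rewrite ?(into_base_reverse _ gG) (into_base_wside gG).
Qed.

(** The local orientation singles out one of the two orientations. *)
Lemma local_factor_uniq t x l b f : wf_seq t l -> coherent t (tl x) ->
  {in Gamma t, xlabel l =1 b} -> f \in l -> f.1 \in pass t (tl x) ->
  (if f.2 is Some w then local_orientation r x f.1 w else true) ->
  f = local_factor t (tl x) b f.1.
Proof.
move=> wfl gd eb fl gp; have gG := factor_Gamma wfl fl.
rewrite /local_factor -(eb _ gG) (xlabelE wfl fl).
have := factor_wf wfl fl; case: f gp gG {fl} => g [w|] //= gp gG ow.
rewrite (local_end gd gp ow) => e; congr (_, Some _).
by rewrite [LHS](orientation_eq gG ow); case: into_base e; case: bside.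
Qed.

Lemma wf_local t x b g : coherent t (tl x) -> g \in pass t (tl x) ->
  wf_factor t (local_factor t (tl x) b g)
  && (if (local_factor t (tl x) b g).2 is Some w then local_orientation r x g w else true).
Proof.
move=> gd gp; have gG := pass_Gamma gp.
rewrite /local_factor /wf_factor /=; case: (b g) => //=.
have ow : orientation t g (if bside t (inl (passing_end t (tl x) g))
                           then g :\: wside t g else wside t g).
  have o1 := wsideP gG; have o2 := orientation_reverse gG o1.
  by case: (bside _ _).
rewrite ow /= (local_end gd gp ow).
by case: (bside _ _); rewrite ?(into_base_reverse _ gG) (into_base_wside gG).
Qed.

Definition away_factors x l : seq (factor G) := [seq f <- l | ~~ passes x f.1].

(** The only expression with labels [b] in the image of [l] under the edge map. *)
Definition target t x b l : seq (factor G) :=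
  map (local_factor t (tl x) b) (pass t (tl x)) ++ away_factors x l.

Lemma components_local t o b (l : seq {set pt G}) : components (map (local_factor t o b) l) = l.
Proof. by rewrite /components -map_comp map_id. Qed.

Lemma components_away x l :
  components (away_factors x l) = [seq g <- components l | ~~ passes x g].
Proof. by rewrite /components filter_map. Qed.

Lemma components_target t x b l :
  components (target t x b l) = pass t (tl x) ++ components (away_factors x l).
Proof. by rewrite /target /components map_cat -map_comp map_id. Qed.

Lemma wf_target s t x b l : same_off x s t -> coherent t (tl x) ->
  wf_seq s l -> wf_seq t (target t x b l).
Proof.
move=> off gd wfl; apply/andP; split.
  rewrite components_target components_away perm_sym.
  have := @perm_pass _ t (tl x) (enum (Gamma t)).
  rewrite hx_topleft => /(_ (enum_uniq _) (fun g => mem_enum _ g)) pe.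
  apply: perm_trans pe _; rewrite perm_cat2l; apply: uniq_perm => [||g].
  - exact/filter_uniq/enum_uniq.
  - exact/filter_uniq/(components_uniq wfl).
  rewrite [LHS]mem_filter [RHS]mem_filter mem_enum (mem_components wfl).
  by case away: (passes x g) => //=; rewrite (Gamma_away off) ?away.
rewrite all_cat; apply/andP; split; apply/allP => f.
  by case/mapP=> g gp ->; have /andP[] := wf_local b gd gp.
rewrite mem_filter => /andP[away fl]; have := factor_wf wfl fl.
rewrite /wf_factor; case: f.2 => // w /andP[sw /forallP ow]; apply/andP; split=> //.
apply/forallP => h; apply/implyP => hg; have /implyP/(_ hg) := ow h.
by rewrite (join_same (same_off_away off away hg)).
Qed.

Lemma wedge_coef_target s t x b l (L := xlabel (target t x b l)) :
  coherent t (tl x) ->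
  wedge_coef r s t x l (target t x b l)
  = eps (components l) (strands r s x ++ components (away_factors x l))
    * local_sign r x l
    * localV (comp s (inl (tl x))) (comp s (inl (opp (tl x))))
             (comp t (inl (tl x))) (comp t (inl (opp (tl x)))) (xlabel l) L.
Proof.
move=> gd; rewrite /wedge_coef strandsE.
have sz : size (pass t (tl x)) = size (map (local_factor t (tl x) b) (pass t (tl x))).
  by rewrite size_map.
rewrite sz take_size_cat // drop_size_cat // components_local !eqxx /= ifT //.
apply/allP => f /mapP[g gp ->]; have /andP[_] := wf_local b gd gp.
by rewrite /local_factor; case: (b g).
Qed.

Lemma xlabel_target s t x b l : wf_seq s l -> same_off x s t -> coherent t (tl x) ->
  away_eq x s (xlabel l) b -> {in Gamma t, xlabel (target t x b l) =1 b}.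
Proof.
move=> wfl off gd /forall_inP ab g gG; have wft := wf_target b off gd wfl.
case: (boolP (passes x g)) => [px|away].
  have gp : g \in pass t (tl x) by rewrite mem_pass // hx_topleft.
  rewrite -{1}[g]/(local_factor t (tl x) b g).1 (xlabelE wft) /=; first by case: (b g).
  by rewrite mem_cat map_f.
have gs : g \in Gamma s by rewrite (Gamma_away off).
have /implyP/(_ away)/eqP <- := ab g gs.
have : g \in components l by rewrite (mem_components wfl).
case/mapP=> f fl eg; rewrite eg (xlabelE wfl fl) (xlabelE wft) //.
by rewrite mem_cat mem_filter -eg away fl orbT.
Qed.

Lemma target_uniq s t x b l l' : wf_seq t l' -> same_off x s t -> coherent t (tl x) ->
  {in Gamma t, xlabel l' =1 b} -> wedge_coef r s t x l l' != 0 ->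
  l' = target t x b l.
Proof.
move=> wfl' off gd eb; rewrite /wedge_coef strandsE; case: ifP; last by rewrite eqxx.
set k := size _; case/and3P=> /eqP ce /eqP de /allP al _.
rewrite -[LHS](cat_take_drop k) de; congr (_ ++ _); rewrite -ce /components -map_comp.
rewrite -[LHS]map_id; apply/eq_in_map => f ft /=.
have fl : f \in l' by exact: mem_take ft.
apply: (local_factor_uniq wfl' gd eb fl); last exact: al.
by rewrite -ce map_f.
Qed.

Lemma target_away s t x l l' b : wf_seq s l -> wf_seq t l' -> same_off x s t ->
  {in Gamma t, xlabel l' =1 b} -> wedge_coef r s t x l l' != 0 ->
  away_eq x s (xlabel l) b.
Proof.
move=> wfl wfl' off eb; rewrite /wedge_coef; case: ifP; last by rewrite eqxx.
set k := size _; case/and3P=> _ /eqP de _ _.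
apply/forall_inP => g gs; apply/implyP => away.
have gG : g \in Gamma t by rewrite -(Gamma_away off).
rewrite -eb //; have : g \in components l by rewrite (mem_components wfl).
case/mapP=> f fl eg; rewrite eg (xlabelE wfl fl) (xlabelE wfl') //.
have : f \in drop k l' by rewrite de mem_filter -eg away fl.
exact: mem_drop.
Qed.

Section Entry.
Variable A : aux G.
Local Notation gaugeA := (gauge (@base_point G) (@index_rank G) A).

Lemma localV_ext s t x a a' b b' :
  {in Gamma s, a =1 a'} -> {in Gamma t, b =1 b'} ->
  localV (comp s (inl (tl x))) (comp s (inl (opp (tl x))))
         (comp t (inl (tl x))) (comp t (inl (opp (tl x)))) a b
  = localV (comp s (inl (tl x))) (comp s (inl (opp (tl x))))
         (comp t (inl (tl x))) (comp t (inl (opp (tl x)))) a' b'.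
Proof.
by move=> ea eb; rewrite /localV /comulV /mulV !ea ?eb ?Gamma_comp.
Qed.

Lemma zeta_edge x s t : edge x s t -> zeta A r t = dirsign (tl x) (odir A x) * zeta A r s.
Proof.
case/andP=> nsx /eqP ->; rewrite /zeta (bigD1 x) /=; last by rewrite ffunE eqxx.
congr (_ * _); apply: eq_bigl => y; rewrite ffunE.
by case: eqVneq => [->|_]; rewrite ?andbF ?andbT // (negbTE nsx).
Qed.

(** Both sides move the components at the crossing to the front and compare
    their orientations with the local one. *)
Lemma osign_target s t x b l : edge x s t -> wf_seq s l ->
  coherent s (tl x) -> coherent t (tl x) ->
  eps (components l) (strands r s x ++ components (away_factors x l))
    * local_sign r x l * osign (target t x b l)
  = osign l * core_sign (@index_rank G) (tl x) s t
    * twist (@base_point G) s (tl x) (xlabel l) * twist (@base_point G) t (tl x) b.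
Proof.
move=> ed wfl gs gt; rewrite -(local_sign_twist wfl gs) -fsign_local //.
rewrite [osign (target _ _ _ _)]/osign components_target.
have pe : perm_eq (components l) (pass s (tl x) ++ components (away_factors x l)).
  rewrite components_away; have := @perm_pass _ s (tl x) (components l).
  rewrite hx_topleft; apply.
    exact: components_uniq wfl.
  by move=> g; rewrite (mem_components wfl).
rewrite strandsE (@eps_rho _ (@index_rank G)) //; last first.
  apply: (map_rank_uniq (@index_rank_inj G) (s := s)); first exact: components_uniq wfl.
  by move=> g; rewrite (mem_components wfl).
have pr : perm_eq (map (@index_rank G) (rest x s))
                  (map (@index_rank G) (components (away_factors x l))).
  rewrite components_away; apply/perm_map/perm_rest => [//||g].
    exact: components_uniq wfl.
  by rewrite (mem_components wfl).
rewrite /core_sign hx_topleft !map_cat !(rho_catr _ pr) /osign big_cat /=.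
rewrite [\prod_(f <- l) fsign f](bigID (fun f => passes x f.1)) /=.
have -> : \prod_(f <- l | ~~ passes x f.1) fsign f = \prod_(f <- away_factors x l) fsign f.
  by rewrite big_filter.
have := rho_sq (map (@index_rank G) (rest x s)).
have := rho_sq (map (@index_rank G) (components (away_factors x l))).
have : \prod_(f <- l | passes x f.1) fsign f * \prod_(f <- l | passes x f.1) fsign f = 1.
  by rewrite -big_split /=; apply: big1 => f _; apply: fsign_sq.
move: (rho (map _ (components (away_factors x l)))) (rho (map _ (rest x s))) => i j.
move: (rho (map _ (components l))) (rho (map _ (pass s _) ++ _)) => k m.
move: (rho (map _ (pass t _) ++ _)) (local_sign _ _ _) => n ls.
move: (\prod_(f <- l | _) _) (\prod_(f <- away_factors _ _) _) => P R.
move: (\prod_(f <- map _ _) _) => Q PP ii jj.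
transitivity (k * m * n * ls * Q * R * (i * i) * (j * j)); first by ring.
by rewrite ii jj !mulr1 -[LHS]mulr1 -PP; ring.
Qed.

(** Unless the local map is zero, a single expression with the labels of [u]
    contributes to the left side, namely [target]. *)
Lemma wedge_entry x (v : wedge G) (u : ckh_gen A) : edge x (wstate v) (tag u) ->
  \sum_(v' : wedge G | wstate v' == tag u)
    wedge_coef r (wstate v) (tag u) x (factors v) (factors v')
    * (wsign A r v' * (under A v' == u)%:R)
  = wsign A r v * entry x (under A v) u.
Proof.
move=> ed; have off := edge_off ed; have flip := edge_flip ed.
set s := wstate v in ed off flip *; set t := tag u in ed off flip *.
set l := factors v; set a := xlabel l; set b := label u.
have wfl : wf_seq s l := wedge_wf v.
have ea : {in Gamma s, label (under A v) =1 a} by exact: label_under.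
have same v' : under A v' = u -> wstate v' = t /\ {in Gamma t, xlabel (factors v') =1 b}.
  move=> e; have es : wstate v' = t by rewrite /t -e.
  by split=> // g gG; rewrite -(@label_under G A v') ?es // e.
rewrite (entryE (@base_pointP G) (@index_rank_inj G) (u := under A v) (w := u) (hx_topleft r x) ed).
rewrite (gauge_ext _ _ _ ea) (core_ext _ _ ea (fun g _ => erefl _)) ?hx_topleft //.
set L := localV (comp s (inl (tl x))) (comp s (inl (opp (tl x))))
               (comp t (inl (tl x))) (comp t (inl (opp (tl x)))) a b.
have coreL : core (@base_point G) (@index_rank G) (tl x) s t a b
    = core_sign (@index_rank G) (tl x) s t * L * twist (@base_point G) s (tl x) a
      * twist (@base_point G) t (tl x) b * (away_eq x s a b)%:R.
  by rewrite /core hx_topleft.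
have nz v' : wedge_coef r s t x l (factors v')
    * (wsign A r v' * (under A v' == u)%:R) != 0 ->
    [/\ under A v' = u, wedge_coef r s t x l (factors v') != 0 & L != 0].
  case: (under A v' =P u) => [e|_]; last by rewrite !mulr0 eqxx.
  move=> nz; have nzc : wedge_coef r s t x l (factors v') != 0.
    by apply: contraNneq nz => ->; rewrite mul0r.
  split=> //; apply: contraNneq nzc => L0; have [_ eb] := same _ e.
  rewrite /wedge_coef; case: ifP => // _.
  by rewrite (localV_ext x (fun g _ => erefl _) eb) -/L L0 mulr0.
have [L0|nzL] := eqVneq L 0.
  rewrite coreL L0 !(mulr0, mul0r); apply: big1 => v' _; apply/eqP.
  by apply: contraTT isT => /nz[_ _]; rewrite L0 eqxx.
have [gs gt] : coherent s (tl x) /\ coherent t (tl x).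
  by apply: localV_along nzL; rewrite hx_topleft.
(* labels that change away from the crossing occur on neither side *)
case: (boolP (away_eq x s a b)) => [ab|nab]; last first.
  rewrite coreL (negbTE nab) !mulr0; apply: big1 => v' _; apply/eqP.
  apply: contraNT nab => /nz[e nzc _]; have [es eb] := same _ e.
  by apply: target_away wfl _ off eb nzc; rewrite -es; apply: wedge_wf.
have wft := wf_target b off gt wfl; have [v0 es0 ev0] := mk_wedge wft.
have eb0 := xlabel_target wfl off gt ab.
have u0 : under A v0 = u.
  apply/eqP/with_labelsP; split; first by rewrite es0.
  by move=> g; rewrite es0 ev0 => gG; rewrite eb0.
rewrite (bigD1 v0) /= ?es0 // big1 => [|v' /andP[_ nv']]; last first.
  apply/eqP; apply: contraNT nv' => /nz[e nzc _]; have [es eb] := same _ e.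
  apply/eqP; apply: wedge_eq; first by rewrite es es0.
  rewrite ev0; apply: target_uniq off gt eb nzc.
  by rewrite -es; apply: wedge_wf.
rewrite addr0 u0 eqxx mulr1 ev0 wedge_coef_target //.
rewrite (localV_ext x (fun g _ => erefl _) eb0) -/L coreL ab mulr1.
rewrite /wsign es0 ev0 (gauge_ext _ _ _ eb0) (zeta_edge ed).
have := osign_target b ed wfl gs gt; rewrite -/s -/l -/a.
have := gauge_sq (@base_point G) (@index_rank G) A s a.
move: (eps _ _ * _) (osign (target _ _ _ _)) (osign l) (core_sign _ _ _ _) => e ot ol c.
move: (gaugeA s a) (gaugeA t b) (dirsign _ _) (zeta A r s) => ga gb d z.
move: (twist _ _ _ _) (twist _ _ _ _) L {coreL nz nzL} => T U L gg key.
transitivity (e * ot * (L * d * z * gb)); first by ring.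
rewrite key; transitivity (ol * c * U * T * (L * d * z * gb) * (ga * ga)); last by ring.
by rewrite gg mulr1.
Qed.

Lemma forget_diff (c : chain (Kh r)) : forget A (diff c) = diff (forget A c).
Proof.
apply/ffunP => u; rewrite !ffunE.
under eq_bigr => v' _ do rewrite ffunE mulr_suml.
under [RHS]eq_bigr => u' _ do rewrite ffunE mulr_suml.
rewrite exchange_big [RHS]exchange_big /=; apply: eq_bigr => v _.
under eq_bigr => v' _ do rewrite -mulrA.
rewrite -mulr_sumr; under [RHS]eq_bigr => u' _ do rewrite -mulrA.
rewrite -mulr_sumr; congr (_ * _).
rewrite [RHS](bigD1 (under A v)) //= [X in _ = _ + X]big1 => [|u' nu']; last first.
  by rewrite [under A v == u']eq_sym (negbTE nu') mulr0 mul0r.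
rewrite eqxx mulr1 addr0 mulr_sumr.
under [RHS]eq_bigr => x ed do rewrite -(wedge_entry ed).
rewrite [RHS](exchange_big_dep (fun v' => wstate v' == tag u)) //=.
rewrite [RHS]big_mkcond; apply: eq_bigr => v' _.
case: (eqVneq (wstate v') (tag u)) => [<-|ne].
  by rewrite mulr_suml; apply: eq_bigl => x; rewrite andbT.
have -> : (under A v' == u) = false by apply: contra_neqF ne => /eqP <-.
by rewrite !mulr0.
Qed.

Lemma forget_chain_map : chain_map (forget A (r := r)).
Proof.
split=> [P c|c nc|c]; first exact: homog_forget.
  by rewrite /= (forget_null A nc); exact: null0.
by rewrite /= forget_diff subrr; exact: null0.
Qed.

(** [forget] is injective modulo relators and commutes with the differentials, so
    its inverse [express] does so modulo relators. *)
Lemma express_chain_map : chain_map (express (A := A) r).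
Proof.
split=> [P c|c nc|c]; first exact: homog_express.
  suff -> : c = 0 by rewrite raddf0; exact: null0.
  by elim: nc => // d d' _ -> _ ->; rewrite subrr.
set e : chain (Kh r) := _ - _.
have := forgetK A e; rewrite (_ : forget A e = 0).
  by rewrite raddf0 sub0r => /nullN; rewrite opprK.
by rewrite /e raddfB /= forget_diff !expressK subrr.
Qed.

Lemma CKh_Kh i : isog (homology (CKh A) i) (homology (Kh r) i).
Proof.
apply: homology_iso express_chain_map forget_chain_map _ _ => [d|c].
  by rewrite /= expressK subrr; exact: null0.
exact: forgetK.
Qed.

End Entry.

End EdgeMaps.

Theorem theorem3 (R : realType) (D : vlink R) :
  (forall (A : aux (gauss_of D)) (v : chain (CKh A)), diff (diff v) = 0) /\
  (forall (A B : aux (gauss_of D)) (i : nat),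
     isog (homology (CKh A) i) (homology (CKh B) i)) /\
  (forall (A : aux (gauss_of D)) (r : gcirc (gauss_of D) -> bool) (i : nat),
     isog (homology (CKh A) i) (homology (Kh r) i)).
Proof.
split; first exact: CKh_square.
split=> [A B i|A r i]; last exact: CKh_Kh.
exact: isog_trans (CKh_Kh (fun=> true) A i) (isog_sym (CKh_Kh (fun=> true) B i)).
Qed.
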